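(* Let $0<q<1$, let $n\ge 2$, and let $P_q$ be the Mallows model through Kendall's tau on the symmetric group $S_n$ (with location parameter the identity), i.e. $P_q(\sigma)=Z^{-1}q^{I(\sigma)}$ for $\sigma\in S_n$, where $I(\sigma)$ is the number of inversions of $\sigma$ and $Z=\sum_{\sigma\in S_n}q^{I(\sigma)}$. Let $D(\sigma)=\{i\in\{1,\dots,n-1\}:\sigma(i+1)<\sigma(i)\}$ be the descent set. (a) The chance that a random permutation chosen from $P_q$ has descent set $\{s_1<s_2<\dots<s_k\}$ is $$\det\left[\frac{1}{(s_{j+1}-s_i)!_q}\right]_{i,j=0}^k,\qquad s_0=0,\ s_{k+1}=n.$$ (b) The point process associated to $D(\sigma)$ is stationary, one-dependent, and determinantal with kernel $K(x,y)=k(y-x)$, where (as formal Laurent series) $$\sum_{m\in\mathbb{Z}}k(m)z^m=\frac{1}{1-\left(\sum_{m=0}^\infty z^m/m!_q\right)^{-1}}.$$ (c) The chance of finding $k$ descents in a row (at $k$ given consecutive positions in $\{1,\dots,n-1\}$) is $q^{\binom{k+1}{2}}/(k+1)!_q$. In particular, the chance of a descent at any given location is $q/(q+1)$. The number of descents has mean $\mu(n,q)=\frac{(n-1)q}{q+1}$ and variance $$q\left[\frac{(q^2-q+1)n-q^2+3q-1}{(q^2+q+1)(q+1)^2}\right].$$ Normalized by its mean and variance, the number of descents has a limiting standard normal distribution (as $n\to\infty$ with $q$ fixed).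
   Context: Notation: $i_q=\frac{q^i-1}{q-1}$ and $m!_q=\prod_{i=1}^m i_q$ (so $0!_q=1$), and $1/m!_q=0$ for $m<0$. A point process on $\{1,\dots,n-1\}$ is a probability measure on its subsets, with correlation function $\rho(A)=P\{S:S\supseteq A\}$. It is stationary if its marginal law on $J$ equals (after translation) its marginal law on $J+i$ whenever $J,J+i\subseteq\{1,\dots,n-1\}$; one-dependent if $\rho(X\cup Y)=\rho(X)\rho(Y)$ whenever $|x-y|\ge2$ for all $x\in X,y\in Y$; determinantal with kernel $K$ if $\rho(A)=\det(K(x,y))_{x,y\in A}$ for all $A$. *)

(* Defs.v *)
From HB Require Import structures.
From mathcomp Require Import all_boot all_order all_algebra all_fingroup.
From mathcomp Require Import all_classical all_reals all_analysis.
Set Implicit Arguments.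
Unset Strict Implicit.
Unset Printing Implicit Defensive.
Import Order.TTheory GRing.Theory Num.Theory.
Import numFieldNormedType.Exports.
Local Open Scope ring_scope.

Section FiniteProbability.
Variables (R : realType) (T : finType).
Implicit Types (P X : T -> R).

Definition is_distribution P := (forall x, 0 <= P x) /\ \sum_x P x = 1.

Definition fin_prob P (E : {set T}) : R := \sum_(x in E) P x.

Definition fin_mean P X : R := \sum_x P x * X x.

Definition fin_var P X : R := fin_mean P (fun x => (X x - fin_mean P X) ^+ 2).

Definition standardize P X x : R :=
  (X x - fin_mean P X) / Num.sqrt (fin_var P X).

Definition law (U : finType) P (Y : T -> U) (u : U) : R :=
  fin_prob P [set x | Y x == u].

End FiniteProbability.

(* The standardized X_ n converge in distribution to N(0, 1). As the limiting *)
(* distribution function is continuous, this is convergence of the            *)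
(* distribution functions at every t.                                         *)
Definition asymptotically_normal (R : realType) (T : nat -> finType)
    (P X : forall n, T n -> R) :=
  forall t : R,
    ((fin_prob (P n) [set x | standardize (P n) (X n) x <= t])%:E
       @[n --> \oo] --> normal_prob 0 1 `]-oo, t])%classic.

(* A point process on {1, ..., N} is given by the mass function P of a        *)
(* probability measure on {set 'I_N}; the element x : 'I_N stands for the     *)
(* position x.+1. All notions below are invariant under this relabelling.     *)
Section PointProcess.
Variables (R : realType) (N : nat).
Implicit Types (P : {set 'I_N} -> R) (A B J X Y : {set 'I_N}).

Definition correlation P A : R := fin_prob P [set S : {set 'I_N} | A \subset S].

(* the law of the restriction S :&: J of the random set S to J *)
Definition marginal P J : {set 'I_N} -> R := law P (fun S => S :&: J).

(* A + i, truncated to the positions that exist *)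
Definition translate (i : int) A : {set 'I_N} :=
  [set y : 'I_N | [exists x in A, y%:Z == x%:Z + i]].

Definition stationary P := forall (i : int) J,
  (forall x, x \in J -> 0 <= x%:Z + i < N%:Z) ->
  forall B, B \subset J ->
  marginal P (translate i J) (translate i B) = marginal P J B.

Definition one_dependent P := forall X Y,
  (forall x y, x \in X -> y \in Y -> 2 <= `|x%:Z - y%:Z|) ->
  correlation P (X :|: Y) = correlation P X * correlation P Y.

Definition determinantal P (K : 'I_N -> 'I_N -> R) := forall A,
  correlation P A = \det (\matrix_(i < #|A|, j < #|A|)
                            K (enum_val i) (enum_val j)).

End PointProcess.

(* A formal Laurent series \sum_m f(m) z^m is its coefficient function.       *)
Section Laurent.
Variable R : realType.
Implicit Types f g : int -> R.

Definition is_laurent f := exists m0 : int, forall m, m < m0 -> f m = 0.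

Definition laurent_one : int -> R := fun m => (m == 0)%:R.

(* the sum has finite support when f and g are Laurent series *)
Definition laurent_mul f g : int -> R :=
  fun m => \sum_(i \in [set: int]%classic) f i * g (m - i).

(* g = 1 / f; Laurent series over R form a field, so that g is unique *)
Definition laurent_inverse f g :=
  is_laurent g /\ laurent_mul f g = laurent_one.

End Laurent.

Section QFactorial.
Variables (R : realType) (q : R).

Definition qint (i : nat) : R := (q ^+ i - 1) / (q - 1).

Definition qfact (m : nat) : R := \prod_(1 <= i < m.+1) qint i.

Definition inv_qfact (m : int) : R :=
  if m is Posz p then (qfact p)^-1 else 0.

End QFactorial.

(* Permutations of {1, ..., n} are represented on {0, ..., n-1}, shifting     *)
(* both arguments and values by one.                                          *)
Section Mallows.
Variable n : nat.
Implicit Types s : 'S_n.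

Definition inversions s : nat :=
  #|[set p : 'I_n * 'I_n | (p.1 < p.2)%N && (s p.2 < s p.1)%N]|.

(* x : 'I_n.-1 is the position x.+1 in {1, ..., n-1} *)
Definition descent_set s : {set 'I_n.-1} :=
  [set x : 'I_n.-1 | [exists i : 'I_n, exists j : 'I_n,
     [&& i == x :> nat, j == x.+1 :> nat & (s j < s i)%N]]].

Definition descents s : nat := #|descent_set s|.

Variables (R : realType) (q : R).

Definition mallowsZ : R := \sum_(s : 'S_n) q ^+ inversions s.

Definition mallows (s : 'S_n) : R := mallowsZ^-1 * q ^+ inversions s.

Definition descent_process : {set 'I_n.-1} -> R := law mallows descent_set.

End Mallows.

Arguments mallowsZ n {R} q.
Arguments mallows n {R} q s.
Arguments descent_process n {R} q _.

(* Main.v *)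
(* Building a permutation by appending its last value, one relative rank at a
   time, turns the Mallows measure into a product measure on the Lehmer code
   c_1, ..., c_n (c_m < m with weight proportional to q^(c_m)), and m is a
   descent exactly when c_m < c_(m+1).  Runs of descents at distance at least
   two therefore involve disjoint sets of code entries, and the probability of
   a run of k descents is a sum over chains 0 <= c_a < ... < c_(a+k) which does
   not depend on a: this gives stationarity, one-dependence, and all marginals.
   The determinants are of Hessenberg type, so each satisfies a recursion along
   its last column, matched with the recursion of the probabilities.  The
   central limit theorem is Stein's method: with W the standardized number of
   descents and f the bounded solution of f'(x) - x f(x) = h(x) - E h(Z), where
   h is a piecewise affine approximation of the indicator of ]-oo, t], local
   dependence makes E[f'(W) - W f(W)] of order 1 / sqrt n. *)

Require Import Defs.
From HB Require Import structures.
From mathcomp Require Import all_boot all_order all_algebra all_fingroup.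
From mathcomp Require Import all_classical all_reals all_analysis.
From mathcomp Require Import ring lra zify.
Set Implicit Arguments.
Unset Strict Implicit.
Unset Printing Implicit Defensive.
Import Order.TTheory GRing.Theory Num.Theory.
Local Open Scope ring_scope.

(** * The Lehmer code *)

Section LehmerCode.
Local Open Scope nat_scope.

(** Every event is expressed through the mean of a product of functions of the single descent
    indicators. Such a mean is affine in each factor: the constant part of a factor forgets its
    position and breaks the code into two independent pieces, while the other part is the indicator
    of a descent, which lengthens the run on its right. Induction on this step replaces any handling
    of joint laws of code entries; cuts, shifts, independence and both determinants come from it,
    with the run probabilities as the only input. A run probability does not see its place because,
    in a strict chain, the bound on the last entry implies the bounds on all the others, so a single
    q-binomial coefficient remains and cancels against the normalizers. In Stein's method the
    indicator is smoothed because the Taylor step needs a Lipschitz derivative [f']; this in turn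
    asks for a bound on [x f'(x)], which in the tails is a two-sided estimate of the Mills ratio. *)

Definition is_descent n (s : 'S_n) (x : nat) : bool :=
  [exists i : 'I_n, exists j : 'I_n,
     [&& i == x :> nat, j == x.+1 :> nat & s j < s i]].

Lemma in_descent_set n (s : 'S_n) (x : 'I_n.-1) :
  (x \in descent_set s) = is_descent s x.
Proof. by rewrite inE. Qed.

Lemma is_descentE n (s : 'S_n) (x : nat) (i j : 'I_n) :
  i = x :> nat -> j = x.+1 :> nat -> is_descent s x = (s j < s i).
Proof.
move=> ix jx; apply/existsP/idP => [[i' /existsP[j' /and3P[/eqP ei /eqP
  ej]]]|ji'].
  have -> : i' = i by apply: val_inj; rewrite /= ei ix.
  by have -> : j' = j by apply: val_inj; rewrite /= ej jx.
by exists i; apply/existsP; exists j; rewrite ji' ix jx !eqxx.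
Qed.

Lemma ltn_lift n (h : 'I_n.+1) (i j : 'I_n) : (lift h i < lift h j) = (i < j).
Proof. by rewrite /= !ltnNge leq_bump2. Qed.

Lemma widen_lift_max n (i : 'I_n) : widen_ord (leqnSn n) i = lift ord_max i.
Proof. by apply: val_inj; rewrite /= /bump leqNgt ltn_ord. Qed.

Lemma card_ord_ge n (j : nat) : \sum_(v < n) (j <= v) = n - j.
Proof.
elim: n => [|n IHn]; first by rewrite big_ord0.
by rewrite big_ord_recr /= IHn; case: leqP; lia.
Qed.

Lemma inversionsE n (s : 'S_n) :
  inversions s = \sum_(i < n) \sum_(k < n) ((i < k) && (s k < s i)).
Proof.
rewrite /inversions -sum1dep_card pair_bigA /= big_mkcond /=.
by apply: eq_bigr => p _; case: ifP.
Qed.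

(** The appended value [j] comes last and is exceeded exactly by the [n - j] earlier values lifted
    over it. *)
Lemma inversions_lift_max n (s : 'S_n) (j : 'I_n.+1) :
  inversions (lift_perm ord_max j s) = inversions s + (n - j).
Proof.
rewrite !inversionsE big_ord_recr /= [X in _ + X]big1 => [|k _]; last first.
  by rewrite ltnNge -ltnS ltn_ord.
rewrite addn0.
have E1 (i : 'I_n) :
  \sum_(k < n.+1) ((i < k) && (lift_perm ord_max j s k <
     lift_perm ord_max j s (widen_ord (leqnSn n) i))) =
  \sum_(k < n) ((i < k) && (s k < s i)) + (j <= s i).
  rewrite big_ord_recr /= !widen_lift_max lift_perm_lift lift_perm_id ltn_ord.
  congr (_ + _).
    by apply: eq_bigr => k _; rewrite widen_lift_max lift_perm_lift ltn_lift.
  by rewrite /= /bump; case: (leqP j (s i)) => h; lia.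
rewrite (eq_bigr _ (fun i _ => E1 i)) big_split /=; congr (_ + _).
rewrite -card_ord_ge [RHS](reindex_inj (@perm_inj _ s)).
by apply: eq_bigr.
Qed.

Lemma is_descent_lift_max n (s : 'S_n) (j : 'I_n.+1) x : x.+1 < n ->
  is_descent (lift_perm ord_max j s) x = is_descent s x.
Proof.
move=> xn; have xn' := ltnW xn.
rewrite (@is_descentE _ s _ (Ordinal xn') (Ordinal xn)) //.
rewrite (@is_descentE _ _ _ (lift ord_max (Ordinal xn')) (lift ord_max (Ordinal
  xn)));
  by rewrite ?lift_max // !lift_perm_lift ltn_lift.
Qed.

(** This counts the earlier values that exceed the last one: the code entry created when the last
    value was appended. *)
Definition code n (s : 'S_n.+1) : nat := n - s ord_max.

Lemma code_lift_max n (s : 'S_n) (j : 'I_n.+1) :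
  code (lift_perm ord_max j s) = n - j.
Proof. by rewrite /code lift_perm_id. Qed.

(** The old last value is lifted above [j] exactly when [j <= s ord_max], which in terms of codes is
    a strict increase. *)
Lemma is_descent_lift_max_last n (s : 'S_n.+1) (j : 'I_n.+2) :
  is_descent (lift_perm ord_max j s) n = (code s < n.+1 - j).
Proof.
rewrite (@is_descentE _ _ _ (lift ord_max ord_max) ord_max) ?lift_max //.
rewrite lift_perm_lift lift_perm_id /code /= /bump.
have := ltn_ord (s ord_max); have := ltn_ord j.
by rewrite /bump leqNgt ltnS; case: (leqP j (s ord_max)) => h; lia.
Qed.

Lemma big_lift_max (R : Type) (idx : R) (op : Monoid.com_law idx) n
    (g : 'S_n.+1 -> R) :
  \big[op/idx]_s g s =
  \big[op/idx]_(j < n.+1) \big[op/idx]_(s : 'S_n) g (lift_perm ord_max j s).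
Proof.
pose f (p : 'I_n.+1 * 'S_n) := lift_perm ord_max p.1 p.2.
have f_inj : injective f.
  move=> [j s] [j' s'] /permP e; rewrite /f /= in e.
  have jj : j = j' by have := e ord_max; rewrite !lift_perm_id.
  congr (_, _) => //; apply/permP => k; have := e (lift ord_max k).
  by rewrite !lift_perm_lift jj => /lift_inj.
have f_bij : bijective f.
  apply: inj_card_bij f_inj _.
  by rewrite card_prod !card_Sn card_ord factS.
rewrite pair_bigA (reindex f) //=.
exact: onW_bij.
Qed.

End LehmerCode.

(** * Products over the descent pattern *)

Section Transfer.
Variables (R : realType) (q : R).
Hypotheses (q_gt0 : 0 < q) (q_lt1 : q < 1).
Implicit Types phi psi : nat -> bool -> R.

Lemma qintE n : qint q n = \sum_(j < n) q ^+ j.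
Proof.
rewrite /qint subrX1 mulrC mulKf // subr_eq0; apply/eqP => q1.
by move: q_lt1; rewrite q1 ltxx.
Qed.

Lemma qint_gt0 n : (0 < n)%N -> 0 < qint q n.
Proof.
case: n => // n _; rewrite qintE big_ord_recl expr0 ltr_pwDl //.
by apply: sumr_ge0 => i _; rewrite exprn_ge0 // ltW.
Qed.

Lemma qint_neq0 n : (0 < n)%N -> qint q n != 0.
Proof. by move/qint_gt0; rewrite lt0r => /andP[]. Qed.

Lemma qfact0 : qfact q 0 = 1.
Proof. by rewrite /qfact big_geq. Qed.

Lemma qfactS n : qfact q n.+1 = qfact q n * qint q n.+1.
Proof. by rewrite /qfact big_nat_recr. Qed.

Lemma qfact_neq0 n : qfact q n != 0.
Proof.
elim: n => [|n IHn]; first by rewrite qfact0 oner_neq0.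
by rewrite qfactS mulf_neq0 // qint_neq0.
Qed.

Lemma mallowsZ_qfact n : mallowsZ n q = qfact q n.
Proof.
rewrite /mallowsZ; elim: n => [|n IHn].
  rewrite qfact0 (big_pred1 1%g) => [|s]; last first.
    by apply/esym/eqP/permP => -[].
  rewrite /inversions (_ : [set _ | _] = finset.set0) ?cards0 //.
  by apply/setP => -[[]].
rewrite big_lift_max qfactS -IHn qintE big_distrr /=.
(* Reversing [j] turns the number [n - j] of new inversions into the exponent of the summand of the
   q-integer. *)
rewrite (reindex_inj rev_ord_inj) /=; apply: eq_bigr => j _.
rewrite big_distrl /=; apply: eq_bigr => s _.
rewrite inversions_lift_max exprD /=; congr (_ * q ^+ _).
by have := ltn_ord j; lia.
Qed.

Definition code_weight (m c : nat) : R := q ^+ c / qint q m.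

Lemma sum_wt m : (0 < m)%N -> \sum_(c < m) code_weight m c = 1.
Proof.
move=> m_gt0; rewrite -big_distrl /= -qintE mulfV // qint_neq0 //.
Qed.

(** For arguments [c <= n] this is the mean, over permutations of [n.+1] elements, of the product of
    the factors before [n], restricted to those whose last code entry is [c]. Larger arguments carry
    no meaning; the base value 1 matters only at [c = 0]. *)
Fixpoint transfer phi n : nat -> R :=
  if n is n'.+1 then fun c' =>
    (\sum_(c < n'.+1) phi n' (c < c')%N * transfer phi n' c) * code_weight
      n'.+2 c'
  else fun=> 1.

(** The test function [h] makes the induction close: once the last value is removed, the factor at
    the last position is a function of the code of what remains. *)
Lemma transfer_sum phi (h : nat -> R) n :
  \sum_(s : 'S_n.+1) mallows n.+1 q s *
     \prod_(x < n) phi x (is_descent s x) * h (code s) =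
  \sum_(c < n.+1) transfer phi n c * h c.
Proof.
elim: n h => [|n IHn] h.
  rewrite big_lift_max !big_ord_recl !big_ord0 !addr0 /=.
  rewrite (big_pred1 1%g) => [|s]; last first.
    by apply/esym/eqP/permP => -[].
  rewrite code_lift_max big_ord0 addr0 mulr1 mul1r sub0n.
  rewrite /mallows inversions_lift_max sub0n addn0 mallowsZ_qfact.
  rewrite qfactS qfact0 qintE big_ord_recl big_ord0 addr0 expr0 mulr1 invr1
    mul1r.
  rewrite /inversions (_ : [set _ | _] = finset.set0) ?cards0 ?mul1r //.
  by apply/setP => -[[]].
rewrite big_lift_max (reindex_inj rev_ord_inj) /=; apply: eq_bigr => j _.
have ej : (n.+1 - (n.+2 - j.+1) = j)%N by have := ltn_ord j; lia.
pose g (c : nat) := phi n (c < j)%N * (code_weight n.+2 j * h j).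
transitivity (\sum_(s : 'S_n.+1) mallows n.+1 q s *
     \prod_(x < n) phi x (is_descent s x) * g (code s)).
  apply: eq_bigr => s _; rewrite big_ord_recr /= code_lift_max /=.
  rewrite is_descent_lift_max_last /= ej.
  rewrite (eq_bigr (fun x : 'I_n => phi x (is_descent s x))) => [|x _]; last
    first.
    by rewrite is_descent_lift_max // ltnS.
  rewrite /mallows inversions_lift_max /= ej !mallowsZ_qfact qfactS exprD.
  rewrite invfM /g /code_weight; ring.
rewrite IHn /g -!mulrA big_distrl /=; apply: eq_bigr => c _; ring.
Qed.

Definition desc_mean phi n := \sum_(c < n.+1) transfer phi n c.

Lemma desc_meanE phi n :
  \sum_(s : 'S_n.+1) mallows n.+1 q s * \prod_(x < n) phi x (is_descent s x) =
  desc_mean phi n.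
Proof.
have := transfer_sum phi (fun=> 1) n.
by under eq_bigr do rewrite mulr1; under [RHS]eq_bigr do rewrite mulr1.
Qed.

Lemma eq_transfer phi psi n : (forall x b, (x < n)%N -> phi x b = psi x b) ->
  transfer phi n =1 transfer psi n.
Proof.
elim: n => // n IHn e c /=; congr (_ * _); apply: eq_bigr => d _.
by rewrite e // IHn // => x b xn; apply: e; rewrite ltnW.
Qed.

Lemma eq_desc_mean phi psi n : (forall x b, (x < n)%N -> phi x b = psi x b) ->
  desc_mean phi n = desc_mean psi n.
Proof. by move=> e; apply: eq_bigr => c _; apply: eq_transfer. Qed.

Definition fresh phi n := forall b, phi n b = 1.

(** When the factor at [n] is 1, nothing compares the new code entry with the earlier ones, so it
    keeps its own law independently of them. *)
Lemma transfer_fresh phi n c : fresh phi n ->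
  transfer phi n.+1 c = desc_mean phi n * code_weight n.+2 c.
Proof.
by move=> e /=; congr (_ * _); apply: eq_bigr => d _; rewrite e mul1r.
Qed.

Lemma desc_mean0 phi : desc_mean phi 0 = 1.
Proof. by rewrite /desc_mean big_ord_recl big_ord0 addr0. Qed.

Lemma desc_mean_fresh phi n : fresh phi n -> desc_mean phi n.+1 = desc_mean phi
  n.
Proof.
move=> e; rewrite /desc_mean; under eq_bigr do rewrite transfer_fresh //.
by rewrite -big_distrr /= sum_wt // mulr1.
Qed.

(* The sum of q^(d_1 + ... + d_i) over all 0 <= d_1 < ... < d_i < c. *)
Definition chain (i c : nat) : R :=
  \prod_(j < i) ((q ^+ c - q ^+ j) / (q ^+ j.+1 - 1)).

Lemma chain0 c : chain 0 c = 1.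
Proof. by rewrite /chain big_ord0. Qed.

Lemma expq_neq1 n : q ^+ n.+1 - 1 != 0.
Proof.
rewrite subr_eq0 lt_eqF // exprn_ilt1 // ?ltW //.
Qed.

Lemma chainS0 i : chain i.+1 0 = 0.
Proof. by rewrite /chain big_ord_recl expr0 subrr !mul0r. Qed.

(** The two terms are the chains without and with [c] as largest entry. Since [chain i c] is
    [q^(i(i-1)/2)] times a q-binomial coefficient, this is the q-Pascal rule. *)
Lemma chainS i c : chain i.+1 c.+1 = chain i.+1 c + q ^+ c * chain i c.
Proof.
suff H : \prod_(j < i.+1) (q ^+ c.+1 - q ^+ j) =
    \prod_(j < i.+1) (q ^+ c - q ^+ j) +
    q ^+ c * (\prod_(j < i) (q ^+ c - q ^+ j)) * (q ^+ i.+1 - 1).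
  rewrite /chain !big_split /= H mulrDl; congr (_ + _).
  rewrite -!mulrA; congr (_ * (_ * _)).
  by rewrite [in LHS]big_ord_recr /= mulrCA mulfV ?mulr1 // expq_neq1.
(* On the left the factor [j = 0] is split off, and [q^(c+1) - q^(j+1) = q (q^c - q^j)] rewrites the
   others. *)
rewrite big_ord_recl [in RHS]big_ord_recr /=.
rewrite (eq_bigr (fun j : 'I_i => q * (q ^+ c - q ^+ j))) => [|j _]; last first.
  by rewrite /bump /= add1n !exprS; ring.
rewrite big_split /= prodr_const card_ord !exprS; ring.
Qed.

Lemma sum_chain i n : \sum_(c < n) q ^+ c * chain i c = chain i.+1 n.
Proof.
elim: n => [|n IHn]; first by rewrite big_ord0 chainS0.
by rewrite big_ord_recr /= IHn chainS.
Qed.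

Definition runprob (k : nat) : R := q ^+ 'C(k.+1, 2) / qfact q k.+1.

(** The numerator of the q-binomial coefficient is the product of the q-integers of
    [n, n-1, ..., n-k], which are the normalizers of the [k.+1] code entries of the run; hence the
    result is free of [n]. *)
Lemma chain_runp k n : (k < n)%N ->
  chain k.+1 n * \prod_(j < k.+1) (qint q (n - j))^-1 = runprob k.
Proof.
move=> kn; rewrite /chain -big_split /= /runprob.
elim: k kn => [|k IHk] kn.
  rewrite big_ord_recl big_ord0 mulr1 subn0 /= qfactS qfact0 mul1r.
  have q1 : q - 1 != 0 by rewrite -[q]expr1 expq_neq1.
  have qn : q ^+ n - 1 != 0 by case: n kn => // n _; rewrite expq_neq1.
  rewrite /qint !expr0 !expr1; field.
  by rewrite q1 qn.
rewrite big_ord_recr /= IHk; last by lia.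
have -> : q ^+ n = q ^+ k.+1 * q ^+ (n - k.+1) by rewrite -exprD; congr (_ ^+
  _); lia.
rewrite (qfactS k.+1) [in RHS]binS bin1 exprD.
have := @qint_neq0 (n - k.+1) ltac:(lia).
have := @qint_neq0 k.+2 isT.
have := qfact_neq0 k.+1.
rewrite /qint; set a := qfact _ _; set b := q ^+ (n - k.+1); move=> a0.
rewrite mulf_eq0 negb_or invr_eq0 => /andP[h1 h3].
rewrite mulf_eq0 negb_or invr_eq0 => /andP[h2 _].
by field; rewrite a0 h1 h2 h3.
Qed.
End Transfer.

(** * Recursion on runs of descents, cuts and independence *)

Section Runs.
Variables (R : realType) (q : R).
Hypotheses (q_gt0 : 0 < q) (q_lt1 : q < 1).
Implicit Types phi psi : nat -> bool -> R.
Notation dmean := (desc_mean q).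
Notation runp := (runprob q).

Lemma runp0 : runp 0 = 1.
Proof. by rewrite /runp /runprob qfactS // qfact0 qintE // big_ord1 mul1r
  divr1. Qed.

(** Along the run the code entries form a strict chain, so each restricted law is a chain sum. [K]
    collects all that happened before, provided that the entry where the run starts still has its
    own law up to this factor. *)
Lemma transfer_run phi M K l :
  (forall x b, (M <= x < M + l)%N -> phi x b = b%:R) ->
  (forall c, (c <= M)%N -> transfer q phi M c = K * code_weight q M.+1 c) ->
  dmean phi (M + l) = K * runp l.
Proof.
move=> des start.
have step i c : (i <= l)%N -> (c <= M + i)%N -> transfer q phi (M + i) c =
    K * (q ^+ c * chain q i c * \prod_(j < i.+1) (qint q ((M + i).+1 - j))^-1).
  elim: i c => [|i IHi] c il cM.
    by rewrite addn0 in cM *; rewrite start // chain0 big_ord1 /= ?subn0 mulr1.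
  rewrite addnS /= /code_weight [X in _ = K * (_ * X)]big_ord_recl /= ?subn0.
  suff -> : \sum_(d < (M + i).+1) phi (M + i)%N (d < c)%N * transfer q phi (M +
    i) d
    = K * (chain q i.+1 c * \prod_(j < i.+1) (qint q ((M + i).+1 - j))^-1).
    rewrite (eq_bigr (fun j : 'I_i.+1 => (qint q ((M + i).+1 - j))^-1)) => [|j
      _].
      by ring.
    by rewrite /bump ?add1n ?subSS.
  (* The range [d < c] already respects the bound [d <= M + i], because [c <= M + i.+1]. *)
  rewrite -sum_chain // (big_ord_widen (M + i).+1 (fun d => q ^+ d * chain q i
    d));
    last by rewrite -addnS.
  rewrite big_distrl big_distrr /= [RHS]big_mkcond; apply: eq_bigr => d _.
  rewrite des; last by lia.
  rewrite IHi; [|exact: ltnW|by have := ltn_ord d; lia].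
  by case: ifP => _; rewrite ?mul1r ?mul0r // !mulrA.
rewrite /desc_mean -(@chain_runp _ _ q_gt0 q_lt1 l (M + l).+1); last by lia.
rewrite -sum_chain // big_distrl big_distrr /=; apply: eq_bigr => d _.
by rewrite step //; exact: (ltn_ord d).
Qed.

(** A run of [l] descents is appended to the factors of [phi] before [N]; keeping [l] variable is
    what allows recursion on [N]. *)
Definition runE phi N l : R :=
  dmean (fun x b => if (x < N)%N then phi x b else b%:R) (N + l).

Lemma runE0 phi N : runE phi N 0 = dmean phi N.
Proof. by rewrite /runE addn0; apply: eq_desc_mean => x b ->. Qed.

Lemma eq_runE phi psi N l : (forall x b, (x < N)%N -> phi x b = psi x b) ->
  runE phi N l = runE psi N l.
Proof. by move=> e; apply: eq_desc_mean => x b _; case: ifP => // /e ->. Qed.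

Lemma run0E phi l : runE phi 0 l = runp l.
Proof.
rewrite /runE (@transfer_run _ 0 1) ?mul1r //.
by move=> [|//] _; rewrite mul1r /code_weight expr0 qintE // big_ord1 expr0
  divr1.
Qed.

Lemma runE_fresh phi N l : fresh phi N ->
  runE phi N.+1 l = dmean phi N * runp l.
Proof.
move=> e; apply: transfer_run => [x b|c _].
  by move=> /andP[h _]; rewrite ltnNge h.
rewrite transfer_fresh; last by move=> b; rewrite ltnSn e.
by congr (_ * _); apply: eq_desc_mean => x b xN; rewrite ltnS ltnW.
Qed.

Definition update_at phi N (u : bool -> R) : nat -> bool -> R :=
  fun x => if x == N then u else phi x.

Lemma desc_mean_linear phi n N (f g : R) (u v : bool -> R) : (N < n)%N ->
  (forall b, phi N b = f * u b + g * v b) ->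
  dmean phi n = f * dmean (update_at phi N u) n + g * dmean (update_at phi N v)
    n.
Proof.
move=> Nn e; rewrite -!desc_meanE // !big_distrr -big_split /=.
apply: eq_bigr => s _.
pose P := \prod_(x < n | x != Ordinal Nn) phi x (is_descent s x).
have updP w : \prod_(x < n) update_at phi N w x (is_descent s x) = w
  (is_descent s N) * P.
  rewrite (bigD1 (Ordinal Nn)) //= /update_at eqxx; congr (_ * _).
  by apply: eq_bigr => i /negbTE; rewrite -val_eqE /= => ->.
rewrite !updP (bigD1 (Ordinal Nn)) //= e -/P; ring.
Qed.

(** Write [phi N b] as [phi N false + (phi N true - phi N false) * b]. The constant makes [N] fresh,
    so the run behind it splits off; the indicator makes [N] the first position of a longer run. *)
Lemma runES phi N l : runE phi N.+1 l =
  phi N false * dmean phi N * runp l +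
  (phi N true - phi N false) * runE phi N l.+1.
Proof.
rewrite {1}/runE (@desc_mean_linear _ _ N (phi N false) (phi N true - phi N
  false)
    (fun=> 1) (fun b => b%:R)); first last.
- by move=> b; rewrite ltnSn; case: b => /=; ring.
- by rewrite addSn ltnS leq_addr.
congr (_ + _ * _); last first.
  rewrite /runE addSnnS; apply: eq_desc_mean => x b _; rewrite /update_at ltnS.
  by case: ltngtP.
rewrite -mulrA; congr (_ * _).
have <- : dmean (update_at phi N (fun=> 1)) N = dmean phi N.
  by apply: eq_desc_mean => x b h; rewrite /update_at ltn_eqF.
rewrite -(@runE_fresh (update_at phi N (fun=> 1))); last by move=> b; rewrite
  /update_at eqxx.
apply: eq_desc_mean => x b _; rewrite /update_at ltnS.
by case: ltngtP.
Qed.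

(** Both sides satisfy the recursion [runES] in [k], which changes [l]; for [k = 0] only the run
    follows the fresh position. *)
Lemma runE_cut phi a k l : fresh phi a ->
  runE phi (a.+1 + k) l = dmean phi a * runE (fun x => phi (a.+1 + x)%N) k l.
Proof.
move=> e; elim: k l => [|k IHk] l; first by rewrite addn0 runE_fresh // run0E.
rewrite addnS runES [runE _ k.+1 l]runES -(runE0 phi (a.+1 + k)) !IHk !runE0.
by ring.
Qed.

Lemma desc_mean_cut phi a k : fresh phi a ->
  dmean phi (a.+1 + k) = dmean phi a * dmean (fun x => phi (a.+1 + x)%N) k.
Proof. by move=> e; rewrite -(runE0 phi) runE_cut // runE0. Qed.

Lemma desc_mean_fresh_tail phi n m : (n <= m)%N ->
  (forall x, (n <= x)%N -> fresh phi x) -> dmean phi m = dmean phi n.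
Proof.
move=> nm e; elim: m nm => [|m IHm]; first by rewrite leqn0 => /eqP ->.
rewrite leq_eqVlt => /predU1P[->//|h].
by rewrite desc_mean_fresh ?IHm // -?ltnS //; apply: e.
Qed.

(** Cutting at the last ignored position leaves a first piece with trivial factors only, of mean 1.
    Translation invariance comes from here. *)
Lemma desc_mean_fresh_head phi a k : (forall x, (x < a)%N -> fresh phi x) ->
  dmean phi (a + k) = dmean (fun x => phi (a + x)%N) k.
Proof.
case: a => [//|a] e; rewrite desc_mean_cut; last exact: e.
rewrite (@eq_desc_mean _ _ _ (fun _ _ => 1)); last first.
  by move=> x b h; rewrite e // ltnW.
by rewrite (@desc_mean_fresh_tail _ 0) // desc_mean0 mul1r.
Qed.

(* [phi] and [psi] depend on sets of positions at distance at least 2. *)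
Definition separated phi psi := forall x,
  fresh phi x \/ [/\ fresh psi x.-1, fresh psi x & fresh psi x.+1].

Lemma separatedC phi psi : separated phi psi -> separated psi phi.
Proof.
move=> sep x; case: (sep x) => [f1|[]]; last by left.
case: (sep x.+1) => [f2|[]]; last by left.
(* At [x = 0] the predecessor [x.-1] is [0] itself, so it asks for nothing new. *)
case: x => [|x] in f1 f2 *; first by right.
by case: (sep x) => [f0|[]]; [right|left].
Qed.

Definition phi_mul phi psi : nat -> bool -> R := fun x b => phi x b * psi x b.

Lemma phi_mulC phi psi x b : phi_mul phi psi x b = phi_mul psi phi x b.
Proof. exact: mulrC. Qed.

(** The run is attached to [phi], so [psi] must also stay away from the position just before it;
    this is the side condition. At each position one of the two functions is trivial, so [runES]
    expands a single factor. *)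
Lemma runE_separated phi psi N l : separated phi psi ->
  ((0 < l)%N -> (0 < N)%N -> fresh psi N.-1) ->
  runE (phi_mul phi psi) N l = runE phi N l * runE psi N 0.
Proof.
elim: N l phi psi => [|N IHN] l phi psi sep cond.
  by rewrite !run0E runp0 mulr1.
have [fpsi|[fphi' fphi _]] := separatedC sep N.
  rewrite !runES -!runE0 /phi_mul !fpsi runp0 !mulr1 IHN // subrr mul0r addr0
    mul1r.
  have [fphi|[fpsi' _ _]] := sep N; first by rewrite !fphi subrr !mul0r; ring.
  by rewrite IHN //; ring.
(* Here [phi] is trivial at [N] and at its neighbours. Without a run, [phi] and [psi] can be
   exchanged; with one, [cond] makes [psi] trivial at [N] as well. *)
case: l cond => [|l] cond.
  rewrite (@eq_runE _ (phi_mul psi phi)) => [|x b _]; last exact: phi_mulC.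
  rewrite [RHS]mulrC !runES -!runE0 /phi_mul !fphi runp0 !mulr1.
  rewrite IHN //; last exact: separatedC.
  rewrite IHN //; last exact: separatedC.
  by rewrite subrr; ring.
have fpsi := cond isT isT; rewrite /= in fpsi.
rewrite !runES -!runE0 /phi_mul !fpsi !fphi runp0 !mulr1 IHN // subrr; ring.
Qed.

Lemma desc_mean_separated phi psi N : separated phi psi ->
  dmean (phi_mul phi psi) N = dmean phi N * dmean psi N.
Proof. by move=> sep; rewrite -!runE0 runE_separated. Qed.

Lemma desc_mean_all_true k : dmean (fun _ b => b%:R) k = runp k.
Proof. by rewrite -(run0E (fun _ b => b%:R)). Qed.

(** Without descents the code never increases, and it starts at 0; so all entries are 0, and the
    product of their weights is the inverse q-factorial. *)
Lemma desc_mean_all_false k : dmean (fun _ b => (~~ b)%:R) k = (qfact q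
  k.+1)^-1.
Proof.
set phi := fun (_ : nat) (b : bool) => (~~ b)%:R : R.
have step n c : (c <= n)%N -> transfer q phi n c = (c == 0)%:R * (qfact q
  n.+1)^-1.
  elim: n c => [|n IHn] c cn.
    move: cn; rewrite leqn0 => /eqP ->.
    by rewrite qfactS // qfact0 qintE // big_ord1 expr0 mulr1 invr1 mulr1.
  rewrite /= big_ord_recl big1 => [|d _]; last first.
    by rewrite IHn ?mulr0n ?mul0r ?mulr0 //=; exact: (ltn_ord d).
  rewrite IHn // eqxx mul1r addr0 /phi lt0n negbK /code_weight (qfactS _ n.+1)
    (invfM (qfact q n.+1)).
  by case: eqP => [->|_] /=; rewrite ?expr0; ring.
rewrite /desc_mean big_ord_recl step // big1 => [|d _].
  by rewrite eqxx mul1r addr0.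
by rewrite step ?mulr0n ?mul0r //=; exact: (ltn_ord d).
Qed.
End Runs.

(** * The descent process *)

Section FiniteProbabilityTheory.
Variables (R : realType) (T : finType).
Implicit Types P X Y : T -> R.

Lemma fin_probE P (Q : pred T) :
  fin_prob P [set x | Q x] = \sum_x P x * (Q x)%:R.
Proof.
rewrite /fin_prob big_mkcond /=; apply: eq_bigr => x _.
by rewrite inE; case: (Q x); rewrite ?mulr1 ?mulr0.
Qed.

Lemma eq_fin_mean P X Y : X =1 Y -> fin_mean P X = fin_mean P Y.
Proof. by move=> XY; apply: eq_bigr => x _; rewrite XY. Qed.

Lemma fin_mean_sum P (I : finType) (F : I -> T -> R) :
  fin_mean P (fun x => \sum_i F i x) = \sum_i fin_mean P (F i).
Proof.
rewrite /fin_mean exchange_big; apply: eq_bigr => x _ /=.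
by rewrite big_distrr.
Qed.

Lemma fin_meanZ P (c : R) X : fin_mean P (fun x => c * X x) = c * fin_mean P X.
Proof. by rewrite /fin_mean big_distrr; apply: eq_bigr => x _ /=; rewrite
  mulrCA. Qed.

Lemma fin_meanD P X Y :
  fin_mean P (fun x => X x + Y x) = fin_mean P X + fin_mean P Y.
Proof. by rewrite /fin_mean -big_split; apply: eq_bigr => x _; rewrite mulrDr.
  Qed.

Lemma fin_meanB P X Y :
  fin_mean P (fun x => X x - Y x) = fin_mean P X - fin_mean P Y.
Proof. by rewrite /fin_mean -sumrB; apply: eq_bigr => x _; rewrite mulrBr. Qed.

Lemma fin_mean_cst P (c : R) : is_distribution P -> fin_mean P (fun=> c) = c.
Proof. by move=> [_ P1]; rewrite /fin_mean -big_distrl /= P1 mul1r. Qed.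

Lemma ler_fin_mean P X Y : is_distribution P ->
  (forall x, X x <= Y x) -> fin_mean P X <= fin_mean P Y.
Proof. by move=> [P0 _] XY; apply: ler_sum => x _; rewrite ler_wpM2l. Qed.

Lemma norm_fin_mean_le P X (c : R) : is_distribution P ->
  (forall x, `|X x| <= c) -> `|fin_mean P X| <= c.
Proof.
move=> dP Xc; rewrite -[leRHS](fin_mean_cst c dP).
apply: le_trans (ler_norm_sum _ _ _) _; apply: ler_sum => x _.
by rewrite normrM ger0_norm ?ler_wpM2l //; case: dP.
Qed.

End FiniteProbabilityTheory.

Lemma fin_prob_law (R : realType) (T U : finType) (P : T -> R) (Y : T -> U) (Q
  : pred U) :
  fin_prob (law P Y) [set u | Q u] = fin_prob P [set x | Q (Y x)].
Proof.
rewrite (fin_probE (law P Y) Q) (fin_probE P (fun x => Q (Y x))) /law.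
under eq_bigr => u _ do rewrite (fin_probE P (fun x => Y x == u)) big_distrl.
rewrite exchange_big /=; apply: eq_bigr => x _.
rewrite (bigD1 (Y x)) //= eqxx mulr1 big1 ?addr0 // => u /negbTE uY.
by rewrite eq_sym uY mulr0 mul0r.
Qed.

Lemma prod_bool (R : realType) (I : finType) (b : I -> bool) :
  \prod_i (b i)%:R = ([forall i, b i])%:R :> R.
Proof.
have -> : [forall i, b i] = \big[andb/true]_i b i by rewrite big_andE.
rewrite (big_morph (fun c : bool => c%:R : R) (id1 := 1) (op1 := *%R)) //.
by move=> [] []; rewrite ?mulr1 ?mulr0.
Qed.

(** Membership is tested on numbers because the factors of [desc_mean] are indexed by all of
    [nat]. *)
Definition memn N (X : {set 'I_N}) (x : nat) : bool := x \in map val (enum X).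

Lemma memnE N (X : {set 'I_N}) (i : 'I_N) : memn X i = (i \in X).
Proof. by rewrite /memn mem_map ?mem_enum //; exact: val_inj. Qed.

Lemma memnP N (X : {set 'I_N}) (x : nat) :
  reflect (exists2 i : 'I_N, i \in X & x = i :> nat) (memn X x).
Proof.
apply: (iffP mapP) => -[i iX ->]; exists i => //; first by rewrite mem_enum in
  iX.
by rewrite mem_enum.
Qed.

Section DescentProcess.
Variables (R : realType) (q : R).
Hypotheses (q_gt0 : 0 < q) (q_lt1 : q < 1).
Variable N : nat.
Notation dmean := (desc_mean q).
Notation runp := (runprob q).
Notation mallows := (mallows N.+1 q).
Implicit Types (X Y J B : {set 'I_N}).

(* the factors of the indicator function of the event D :&: X = B *)
Definition pattern (X B : {set 'I_N}) (x : nat) (b : bool) : R :=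
  if memn X x then (b == memn B x)%:R else 1.

Lemma pattern_fresh X B (x : nat) : ~~ memn X x -> fresh (pattern X B) x.
Proof. by move=> /negbTE h b; rewrite /pattern h. Qed.

Lemma fin_prob_desc_mean (phi : nat -> bool -> R) (Q : pred 'S_N.+1) :
  (forall w, (Q w)%:R = \prod_(x < N) phi x (is_descent w x)) ->
  fin_prob mallows [set w : 'S_N.+1 | Q w] = dmean phi N.
Proof.
move=> e; rewrite fin_probE -desc_meanE //.
by apply: eq_bigr => w _; rewrite e.
Qed.

Lemma pattern_prod X B (w : 'S_N.+1) : B \subset X ->
  (descent_set w :&: X == B)%:R = \prod_(x < N) pattern X B x (is_descent w x).
Proof.
move=> BX; rewrite /pattern.
rewrite (eq_bigr (fun x : 'I_N => ((x \in X) ==> (is_descent w x == (x \in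
  B)))%:R));
  last by move=> x _; rewrite !memnE; case: (x \in X).
rewrite prod_bool; congr (_%:R); congr nat_of_bool; apply/eqP/forallP.
  move=> <- x; rewrite inE -in_descent_set; apply/implyP => ->.
  by rewrite andbT.
move=> h; apply/setP => x; rewrite inE in_descent_set.
have := h x; case: (boolP (x \in X)) => [_ /eqP ->|xX _]; first by rewrite
  andbT.
by rewrite andbF; apply/esym/negbTE; apply: contra xX => /(fintype.subsetP BX).
Qed.

Lemma pattern_prob X B : B \subset X ->
  fin_prob mallows [set w : 'S_N.+1 | descent_set w :&: X == B] = dmean
    (pattern X B) N.
Proof. by move=> BX; apply: fin_prob_desc_mean => w; apply: pattern_prod. Qed.

Lemma subset_prob X :
  fin_prob mallows [set w : 'S_N.+1 | X \subset descent_set w] = dmean (pattern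
    X X) N.
Proof.
rewrite -pattern_prob //; congr (fin_prob _ _); apply/setP => w; rewrite !inE.
by exact: (sameP finset.setIidPr eqP).
Qed.

Definition far X Y := forall x y, x \in X -> y \in Y -> 2 <= `|x%:Z - y%:Z|.

Lemma pattern_separated X Y B B' : far X Y ->
  separated (pattern X B) (pattern Y B').
Proof.
move=> XY x; case: (boolP (memn X x)) => [/memnP[i iX ->]|]; last first.
  by left; apply: pattern_fresh.
right; split; apply: pattern_fresh; apply/memnP => -[j jY e];
  by have := XY _ _ iX jY; move: e; case: (nat_of_ord i) => [|?]; lia.
Qed.

Lemma mallows_sum1 : \sum_w mallows w = 1.
Proof.
rewrite -big_distrr /= -/(mallowsZ _ _) mallowsZ_qfact // mulVf // qfact_neq0
  //.
Qed.

Lemma mallows_ge0 w : 0 <= mallows w.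
Proof.
rewrite /Defs.mallows mulr_ge0 ?exprn_ge0 ?(ltW q_gt0) // invr_ge0.
by apply: sumr_ge0 => s _; rewrite exprn_ge0 // ltW.
Qed.

Lemma mallows_distribution : is_distribution mallows.
Proof. by split; [exact: mallows_ge0|exact: mallows_sum1]. Qed.

(** Functions of the two restrictions are linear combinations of pattern indicators, to which
    [desc_mean_separated] applies. Stein's method needs this generality, not only correlations. *)
Lemma fin_mean_indep X Y (g h : {set 'I_N} -> R) : far X Y ->
  fin_mean mallows
    (fun w : 'S_N.+1 => g (descent_set w :&: X) * h (descent_set w :&: Y)) =
  fin_mean mallows (fun w : 'S_N.+1 => g (descent_set w :&: X)) *
  fin_mean mallows (fun w : 'S_N.+1 => h (descent_set w :&: Y)).
Proof.
move=> XY.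
have expand Z (f : {set 'I_N} -> R) (w : 'S_N.+1) : f (descent_set w :&: Z) =
    \sum_(B : {set 'I_N} | B \subset Z) f B * \prod_(x < N) pattern Z B x
      (is_descent w x).
  rewrite (bigD1 (descent_set w :&: Z)) ?subsetIr //= -pattern_prod ?subsetIr
    //.
  rewrite eqxx mulr1 big1 ?addr0 // => B /andP[BZ].
  by rewrite -pattern_prod // eq_sym => /negbTE ->; rewrite mulr0.
have mean1 Z (f : {set 'I_N} -> R) :
    fin_mean mallows (fun w : 'S_N.+1 => f (descent_set w :&: Z)) =
    \sum_(B : {set 'I_N} | B \subset Z) f B * dmean (pattern Z B) N.
  rewrite /fin_mean; under eq_bigr do rewrite expand big_distrr.
  rewrite exchange_big; apply: eq_bigr => B _ /=.
  by rewrite -desc_meanE // big_distrr; apply: eq_bigr => w _; rewrite /=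
    mulrCA.
rewrite !mean1 /fin_mean big_distrl /=.
under eq_bigr do rewrite !expand big_distrl big_distrr.
rewrite exchange_big; apply: eq_bigr => B _ /=.
rewrite big_distrr; under eq_bigr do rewrite /= big_distrr big_distrr.
rewrite exchange_big; apply: eq_bigr => B' _ /=.
rewrite mulrACA -desc_mean_separated //; last exact: pattern_separated.
rewrite -desc_meanE // big_distrr; apply: eq_bigr => w _ /=.
by rewrite big_split /=; ring.
Qed.

Lemma correlationE X : correlation (descent_process N.+1 q) X = dmean (pattern
  X X) N.
Proof. by rewrite /correlation fin_prob_law subset_prob. Qed.

Lemma marginalE J B : B \subset J ->
  marginal (descent_process N.+1 q) J B = dmean (pattern J B) N.
Proof.
by move=> BJ; rewrite /marginal {1}/law fin_prob_law (pattern_prob BJ).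
Qed.

Lemma process_distribution : is_distribution (descent_process N.+1 q).
Proof.
split=> [S|]; first by apply: sumr_ge0 => w _; apply: mallows_ge0.
have := fin_prob_law mallows (@descent_set N.+1) xpredT.
rewrite !fin_probE; under eq_bigr do rewrite mulr1.
by under [RHS]eq_bigr do rewrite mulr1; rewrite mallows_sum1.
Qed.

Lemma memnU X Y (x : nat) : memn (X :|: Y) x = memn X x || memn Y x.
Proof.
apply/memnP/orP => [[i]|[/memnP[i iX ->]|/memnP[i iX ->]]].
- by rewrite inE => /orP[] h ->; [left|right]; rewrite memnE.
- by exists i; rewrite // inE iX.
- by exists i; rewrite // inE iX orbT.
Qed.

Lemma process_one_dependent : one_dependent (descent_process N.+1 q).
Proof.
move=> X Y XY; rewrite !correlationE -desc_mean_separated //; last first.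
  exact: pattern_separated.
apply: eq_desc_mean => x b _; rewrite /phi_mul /pattern memnU.
case: (memn X x); case: (memn Y x); rewrite ?mulr1 ?mul1r //.
by case: b; rewrite /= ?mulr1 ?mulr0.
Qed.

(** Dropping the trivial factors, at the start of [psi] and at the end of [phi], leaves the same
    mean over [N - k] positions. *)
Lemma desc_mean_shift (phi psi : nat -> bool -> R) k : (k <= N)%N ->
  (forall x, (x < k)%N -> fresh psi x) ->
  (forall x b, psi (k + x)%N b = phi x b) ->
  (forall x, (N - k <= x)%N -> fresh phi x) ->
  dmean psi N = dmean phi N.
Proof.
move=> kN psi0 e phi1.
rewrite (@desc_mean_fresh_tail _ _ _ _ phi (N - k)%N) ?leq_subr //.
rewrite -{1}(subnKC kN) desc_mean_fresh_head //.
by apply: eq_desc_mean => x b _; rewrite e.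
Qed.

Lemma process_stationary : stationary (descent_process N.+1 q).
Proof.
move=> i; rewrite /= => J rg B BJ.
(* By [rg], no point of a translated subset of [J] is lost by truncation. *)
have memT (A : {set 'I_N}) (y : nat) : A \subset J ->
    reflect (exists2 x : 'I_N, x \in A & y%:Z = x%:Z + i) (memn (translate i A)
      y).
  move=> AJ; apply: (iffP (memnP _ _)) => [[z]|[x xA ey]].
    by rewrite inE => /existsP[x /andP[xA /eqP e]] ->; exists x.
  have yN : (y < N)%N by have := rg _ (fintype.subsetP AJ _ xA); rewrite -ey
    ltz_nat => /andP[].
  exists (Ordinal yN) => //; rewrite inE; apply/existsP; exists x.
  by rewrite xA /= ey eqxx.
have tBJ : translate i B \subset translate i J.
  apply/fintype.subsetP => y; rewrite !inE => /existsP[x /andP[xB e]].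
  by apply/existsP; exists x; rewrite (fintype.subsetP BJ) ?xB.
rewrite !marginalE //.
(* For empty [J] the hypothesis puts no bound on [i], so no shift within range is available; both
   events are then certain. *)
have [J0|[x0 x0J]] := set_0Vmem J.
  have fr A (x : nat) : fresh (pattern finset.set0 A) x.
    by apply: pattern_fresh; apply/memnP => -[y]; rewrite inE.
  have -> : translate i J = finset.set0.
    apply/setP => y; rewrite !inE; apply/existsP => -[x].
    by rewrite J0 inE.
  by rewrite J0 !(@desc_mean_fresh_tail _ _ _ _ _ 0 N) // ?desc_mean0 // => x
    _; apply: fr.
have x0i := rg _ x0J; have x0N := ltn_ord x0.
have memTk k (A : {set 'I_N}) (x : nat) : A \subset J -> i = k%:Z -> memn
  (translate i A) (k + x)%N = memn A x.
  move=> AJ ik; apply/memT/memnP => // -[y yA e]; exists y => //; lia.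
have memTk' k (A : {set 'I_N}) (x : nat) : A \subset J -> i = - k%:Z -> memn
  (translate i A) x = memn A (k + x)%N.
  move=> AJ ik; apply/memT/memnP => // -[y yA e]; exists y => //; lia.
case: (ltrP i 0) => [i0|i0].
  pose k := `|i|%N; have ik : i = - k%:Z by rewrite /k; lia.
  (* A shift to the left is a shift to the right with the two patterns exchanged. *)
  symmetry; apply: (@desc_mean_shift _ _ k); first by lia.
  - move=> x xk; apply: pattern_fresh; apply/memnP => -[y yJ e].
    by have := rg _ yJ; lia.
  - by move=> x b; rewrite /pattern !(memTk' k).
  - move=> x xk; apply: pattern_fresh; apply/memT => // -[y yJ e].
    by have := ltn_ord y; lia.
pose k := `|i|%N; have ik : i = k%:Z by rewrite /k; lia.
apply: (@desc_mean_shift _ _ k); first by lia.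
- move=> x xk; apply: pattern_fresh; apply/memT => // -[y yJ e]; lia.
- by move=> x b; rewrite /pattern !(memTk k).
- move=> x xk; apply: pattern_fresh; apply/memnP => -[y yJ e].
  by have := rg _ yJ; lia.
Qed.


Lemma run_prob a k : (1 <= a)%N -> (a + k <= N.+1)%N ->
  fin_prob mallows [set w : 'S_N.+1 | [forall x : 'I_N,
     (a <= x.+1 < a + k)%N ==> (x \in descent_set w)]] = runp k.
Proof.
case: a => // a _ akN.
rewrite (@fin_prob_desc_mean (fun x b => if (a <= x < a + k)%N then b%:R else
  1)).
  have eN : N = (a + (N - a))%N by lia.
  rewrite {1}eN.
  rewrite desc_mean_fresh_head => [|//|//|x xa b]; last by rewrite leqNgt xa.
  rewrite (@desc_mean_fresh_tail _ _ _ _ _ k) //; first last.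
  - by move=> x kx b; rewrite ifF //; lia.
  - by lia.
  rewrite -desc_mean_all_true //; apply: eq_desc_mean => x b xk.
  by rewrite ifT //; lia.
move=> w; rewrite -prod_bool; apply: eq_bigr => x _.
by rewrite (in_descent_set w) addSn !ltnS; case: ifP.
Qed.

Definition desc_ind (x : 'I_N) (w : 'S_N.+1) : R := (x \in descent_set w)%:R.

Lemma descent_prob (x : 'I_N) :
  fin_prob mallows [set w : 'S_N.+1 | x \in descent_set w] = runp 1.
Proof.
rewrite -(@run_prob x.+1) //; last by rewrite addn1 ltnS.
congr (fin_prob _ _); apply/setP => w; rewrite !inE; apply/idP/forallP => [h
  y|].
  apply/implyP => yx; have -> : y = x by apply: val_inj => /=; lia.
  by rewrite inE.
by move=> /(_ x); rewrite inE addn1 !leqnn.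
Qed.

Lemma mean_ind x : fin_mean mallows (desc_ind x) = runp 1.
Proof. by rewrite -(descent_prob x) fin_probE. Qed.

Lemma adjacent_prob (x y : 'I_N) : y = x.+1 :> nat ->
  fin_mean mallows (fun w => desc_ind x w * desc_ind y w) = runp 2.
Proof.
move=> yx; rewrite -(@run_prob x.+1 2) //; last by have := ltn_ord y; lia.
rewrite fin_probE; apply: eq_bigr => w _; congr (_ * _).
rewrite /desc_ind -natrM mulnb; congr (_%:R); congr nat_of_bool.
apply/andP/forallP => [[hx hy] z|h].
  apply/implyP => hz; have [e|e] : z = x :> nat \/ z = y :> nat by lia.
    by rewrite (val_inj e).
  by rewrite (val_inj e).
by split; [have := h x|have := h y]; move/implyP; apply; lia.
Qed.

Lemma far_prob (x y : 'I_N) : 2 <= `|x%:Z - y%:Z| ->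
  fin_mean mallows (fun w => desc_ind x w * desc_ind y w) = runp 1 ^+ 2.
Proof.
move=> xy.
have e z w : desc_ind z w = (z \in descent_set w :&: [set z]%SET)%:R.
  by rewrite /desc_ind !inE eqxx andbT.
rewrite expr2 -{1}(mean_ind x) -(mean_ind y).
transitivity (fin_mean mallows (fun w : 'S_N.+1 =>
    (x \in descent_set w :&: [set x]%SET)%:R * (y \in descent_set w :&: [set
      y]%SET)%:R)).
  by apply: eq_bigr => w _; rewrite !e.
rewrite (@fin_mean_indep _ _ (fun S => (x \in S)%:R) (fun S => (y \in S)%:R)).
  by congr (_ * _); apply: eq_bigr => w _; rewrite e.
by move=> i j; rewrite !inE => /eqP -> /eqP ->.
Qed.

Lemma descents_ind w : (descents w)%:R = \sum_x desc_ind x w.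
Proof.
rewrite /descents -sum1_card big_mkcond natr_sum; apply: eq_bigr => x _.
by rewrite /desc_ind; case: ifP.
Qed.

Lemma mean_descents :
  fin_mean mallows (fun w => (descents w)%:R) = N%:R * runp 1.
Proof.
transitivity (fin_mean mallows (fun w => \sum_x desc_ind x w)).
  by apply: eq_bigr => w _; rewrite descents_ind.
rewrite fin_mean_sum; under eq_bigr do rewrite mean_ind.
by rewrite sumr_const card_ord mulr_natl.
Qed.

Definition desc_cov (x y : nat) : R :=
  if x == y then runp 1 - runp 1 ^+ 2
  else if (x == y.+1) || (y == x.+1) then runp 2 - runp 1 ^+ 2 else 0.

Lemma cov_ind (x y : 'I_N) :
  fin_mean mallows (fun w => (desc_ind x w - runp 1) * (desc_ind y w - runp 1))
    = desc_cov x y.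
Proof.
transitivity (fin_mean mallows (fun w => desc_ind x w * desc_ind y w +
    (- runp 1 * desc_ind x w + (- runp 1 * desc_ind y w + runp 1 ^+ 2)))).
  by apply: eq_bigr => w _; congr (_ * _); ring.
rewrite !fin_meanD (fin_mean_cst _ mallows_distribution) !(fin_meanZ _ (- runp
  1)) !mean_ind /desc_cov.
have [exy|nxy] := eqVneq (x : nat) y.
  rewrite (val_inj exy) (_ : fin_mean _ _ = runp 1); first by ring.
  rewrite -(mean_ind y); apply: eq_bigr => w _; congr (_ * _).
  by rewrite /desc_ind; case: (_ \in _); rewrite ?mulr1 ?mulr0.
have [xy|xy] := boolP (_ == _).
  rewrite (_ : fin_mean _ _ = runp 2); first by ring.
  rewrite -(@adjacent_prob y x); last exact/eqP.
  by apply: eq_bigr => w _; congr (_ * _); rewrite mulrC.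
have [yx|yx] := boolP (_ == _).
  by rewrite /= (@adjacent_prob x y) ?(eqP yx) //; ring.
by rewrite /= far_prob; [ring|lia].
Qed.

Lemma sum_cov n : \sum_(x < n.+1) \sum_(y < n.+1) desc_cov x y =
  n.+1%:R * (runp 1 - runp 1 ^+ 2) + 2 * n%:R * (runp 2 - runp 1 ^+ 2).
Proof.
have covC x y : desc_cov x y = desc_cov y x.
  by rewrite /desc_cov [y == x]eq_sym; case: (x == y); rewrite // orbC.
have last_col m : \sum_(x < m.+1) desc_cov x m.+1 = runp 2 - runp 1 ^+ 2.
  rewrite big_ord_recr /= big1 ?add0r => [|x _].
    by rewrite /desc_cov eqxx orbT ltn_eqF.
  have := ltn_ord x; rewrite /desc_cov => xm.
  by rewrite !ifF //; lia.
elim: n => [|n IHn].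
  by rewrite !big_ord_recl !big_ord0 /desc_cov /= !addr0; ring.
rewrite big_ord_recr /= [X in _ + X]big_ord_recr /=.
under eq_bigr do rewrite big_ord_recr /=.
rewrite big_split /= IHn last_col.
under eq_bigr do rewrite covC.
by rewrite last_col /desc_cov eqxx -[n.+2%:R]natr1 -[n.+1%:R]natr1; ring.
Qed.

Lemma var_descents_sum :
  fin_var mallows (fun w => (descents w)%:R) = \sum_(x < N) \sum_(y < N)
    desc_cov x y.
Proof.
rewrite /fin_var mean_descents.
transitivity (fin_mean mallows (fun w =>
    \sum_x \sum_y (desc_ind x w - runp 1) * (desc_ind y w - runp 1))).
  apply: eq_bigr => w _; congr (_ * _).
  rewrite descents_ind expr2.
  have -> : \sum_x desc_ind x w - N%:R * runp 1 = \sum_x (desc_ind x w - runp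
    1).
    by rewrite sumrB sumr_const card_ord mulr_natl.
  rewrite big_distrl; apply: eq_bigr => x _ /=.
  by rewrite big_distrr.
rewrite fin_mean_sum; apply: eq_bigr => x _.
by rewrite fin_mean_sum; apply: eq_bigr => y _; rewrite cov_ind.
Qed.

Lemma runp1 : runp 1 = q / (q + 1).
Proof.
rewrite /runp /runprob binn expr1 !qfactS qfact0 !qintE // !big_ord_recl
  !big_ord0 /=.
rewrite /bump /= !expr0; congr (_ / _); ring.
Qed.

Lemma runp2 : runp 2 = q ^+ 3 / ((q + 1) * (q ^+ 2 + q + 1)).
Proof.
rewrite /runp /runprob !qfactS qfact0 !qintE // !big_ord_recl !big_ord0 /=.
rewrite /bump /= !expr0; congr (_ / _); ring.
Qed.

Lemma var_descents : (0 < N)%N ->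
  fin_var mallows (fun w => (descents w)%:R) =
  q * (((q ^+ 2 - q + 1) * N.+1%:R - q ^+ 2 + 3 * q - 1) /
       ((q ^+ 2 + q + 1) * (q + 1) ^+ 2)).
Proof.
move=> N0; rewrite var_descents_sum; case: N N0 => // n _.
rewrite sum_cov runp1 runp2 -[n.+2%:R]natr1 -[n.+1%:R]natr1.
have h1 : q + 1 != 0 by rewrite gt_eqF // addr_gt0.
have h2 : q ^+ 2 + q + 1 != 0 by rewrite gt_eqF // !addr_gt0 // exprn_gt0.
by field; rewrite h1 h2.
Qed.

End DescentProcess.

(** * Hessenberg determinants and Laurent series *)

Section Hessenberg.
Variables (R : comPzRingType) (M : nat -> nat -> R).

(** The last column is free so that the family is closed under expansion: the minor without the last
    row and the column before the last still ends with [v]. *)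
Definition hess (v : nat -> R) k : R :=
  \det (\matrix_(i < k.+1, j < k.+1) if j == k :> nat then v i else M i j).

Lemma hess0 v : hess v 0 = v 0%N.
Proof. by rewrite /hess det_mx11 mxE. Qed.

(** In the last row only the two rightmost entries can be nonzero. Deleting the last column leaves a
    plain minor, whose last column is the column [M^~ k]. *)
Lemma hessS v k : (forall j, (j < k)%N -> M k.+1 j = 0) ->
  hess v k.+1 = v k.+1 * hess (M^~ k) k - M k.+1 k * hess v k.
Proof.
move=> M0; rewrite /hess (expand_det_row _ ord_max) !big_ord_recr /= big1.
  rewrite add0r !mxE /= eqxx ltn_eqF //= /cofactor /=.
  rewrite addrC; congr (_ * _ + _).
    rewrite addnn -signr_odd odd_double mul1r; congr (\det _).
    apply/matrixP => i j; rewrite !mxE /= /bump.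
    rewrite (leqNgt k.+1 i) (leqNgt k.+1 j) !ltn_ord /= !add0n ltn_eqF //.
    by case: eqP => [->|].
  rewrite -mulrN; congr (_ * _).
  rewrite addSn addnn -signr_odd /= odd_double mulN1r; congr (- \det _).
  apply/matrixP => i j; rewrite !mxE /= /bump.
  rewrite (leqNgt k.+1 i) ltn_ord add0n.
  have := ltn_ord j; rewrite ltnS => jk.
  case: (ltngtP k j) => [h|h|h]; first by rewrite ltnNge jk in h.
    by rewrite add0n ltn_eqF // ltnS ltnW.
  by rewrite add1n -h eqxx.
move=> j _; rewrite !mxE /= ltn_eqF ?M0 ?mul0r //.
by rewrite ltnS ltnW.
Qed.

End Hessenberg.

Section PowerSeriesInverse.
Variables (R : comPzRingType) (a : nat -> R).

(** A new coefficient needs all earlier ones, so the structural recursion builds the table of the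
    first [n] of them, with 0 beyond. The formula inverts a series of constant term 1. *)
Fixpoint series_inv_upto n : nat -> R :=
  if n is m.+1 then
    let b := series_inv_upto m in
    fun i => if i == m then (m == 0)%:R - \sum_(j < m) b j * a (m - j)%N else b
      i
  else fun=> 0.

Definition series_inv n : R := series_inv_upto n.+1 n.

Lemma series_invE n :
  series_inv n = (n == 0)%:R - \sum_(j < n) series_inv j * a (n - j)%N.
Proof.
have stable m i : (i < m)%N -> series_inv_upto m i = series_inv i.
  elim: m => //= m IHm; rewrite ltnS leq_eqVlt => /predU1P[->|im].
    by rewrite /series_inv /= eqxx.
  by rewrite ltn_eqF // IHm.
rewrite {1}/series_inv /= eqxx; congr (_ - _).
by apply: eq_bigr => j _; rewrite stable.
Qed.

Lemma series_inv_conv n : a 0%N = 1 ->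
  \sum_(j < n.+1) a j * series_inv (n - j)%N = (n == 0)%:R.
Proof.
move=> a0; rewrite (reindex_inj rev_ord_inj) big_ord_recr /= subnn a0 mul1r.
rewrite [series_inv (n - 0)]series_invE subn0 addrC.
rewrite [X in _ + X](eq_bigr (fun j : 'I_n => series_inv j * a (n - j)%N))
  ?subrK // => j _.
by rewrite mulrC subSS; congr (series_inv _ * _); have := ltn_ord j; lia.
Qed.

End PowerSeriesInverse.

Section LaurentSeries.
Variable R : realType.
Implicit Types (a b : int) (u v : nat -> R).

(* the Laurent series z^a (u_0 + u_1 z + u_2 z^2 + ...) *)
Definition laurent a u : int -> R := fun m => if m - a is Posz p then u p else
  0.

Lemma laurentE a u p : laurent a u (a + p%:Z) = u p.
Proof. by rewrite /laurent addrC addKr. Qed.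

Lemma laurent_lt a u m : m < a -> laurent a u m = 0.
Proof. by rewrite /laurent; case E : (m - a) => [p|p] // ma; lia. Qed.

Lemma laurent_is_laurent a u : is_laurent (laurent a u).
Proof. by exists a => m; apply: laurent_lt. Qed.

Lemma laurent_mulE a b u v n :
  laurent_mul (laurent a u) (laurent b v) (a + b + n%:Z) =
  \sum_(i < n.+1) u i * v (n - i)%N.
Proof.
rewrite /laurent_mul (@fsbigE _ _ _ _ _ [seq a + j%:Z | j <- iota 0 n.+1]).
- rewrite big_map -[iota 0 n.+1]/(index_iota 0 n.+1) big_mkord.
  apply: eq_big => [i|i _]; first by rewrite in_setT.
  rewrite laurentE (_ : _ - _ = b + (n - i)%N%:Z) ?laurentE //.
  by have := ltn_ord i; lia.
- by rewrite map_inj_uniq ?iota_uniq // => i j; lia.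
- by [].
move=> i _ /mapP ni.
have [ia|ia] := ltrP i a; first by rewrite laurent_lt ?mul0r.
rewrite [X in _ * X]laurent_lt ?mulr0 // ltNge; apply/negP => h.
by apply: ni; exists `|i - a|%N; [rewrite mem_iota|]; lia.
Qed.

Lemma laurent_mul_lt a b u v m : m < a + b ->
  laurent_mul (laurent a u) (laurent b v) m = 0.
Proof.
move=> mab; rewrite /laurent_mul fsbig1 // => i _.
have [ia|ia] := ltrP i a; first by rewrite laurent_lt ?mul0r.
by rewrite [X in _ * X]laurent_lt ?mulr0 //; lia.
Qed.

Lemma laurent_inverseP a u v :
  (forall n, \sum_(i < n.+1) u i * v (n - i)%N = (n == 0%N)%:R) ->
  laurent_inverse (laurent a u) (laurent (- a) v).
Proof.
move=> uv; split; first exact: laurent_is_laurent.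
apply/funext => m; rewrite /laurent_one.
have [m0|m0] := ltrP m 0.
  by rewrite laurent_mul_lt ?subrr // lt_eqF.
have -> : m = a + (- a) + `|m|%N%:Z by lia.
rewrite laurent_mulE uv; congr (_%:R); congr nat_of_bool.
by apply/eqP/eqP; lia.
Qed.

End LaurentSeries.

(** * The determinants of the descent set and of the correlation functions *)

Section DescentDeterminants.
Variables (R : realType) (q : R).
Hypotheses (q_gt0 : 0 < q) (q_lt1 : q < 1).
Notation dmean := (desc_mean q).
Notation runE := (runE q).
Notation runp := (runprob q).

Lemma inv_qfact_lt0 (m : int) : m < 0 -> inv_qfact q m = 0.
Proof. by case: m. Qed.

Lemma increasing_leq (X : nat -> nat) k :
  (forall i, (i < k)%N -> (X i < X i.+1)%N) ->
  forall i j, (i <= j <= k)%N -> (X i <= X j)%N.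
Proof.
move=> incr i j /andP[]; elim: j => [|j IHj]; first by rewrite leqn0 => /eqP ->.
rewrite leq_eqVlt => /predU1P[->//|ij jk].
by apply: leq_trans (IHj ij (ltnW jk)) (ltnW (incr _ jk)).
Qed.

Lemma in_prefix (X : nat -> nat) k x :
  reflect (exists2 i, (i < k)%N & x = X i) (x \in [seq X i | i <- iota 0 k]).
Proof.
apply: (iffP mapP) => -[i ik ->]; exists i => //.
  by rewrite mem_iota in ik.
by rewrite mem_iota.
Qed.

Lemma in_prefixS (X : nat -> nat) k x :
  (x \in [seq X i | i <- iota 0 k.+1]) =
  (x \in [seq X i | i <- iota 0 k]) || (x == X k).
Proof. by rewrite -addn1 iotaD map_cat mem_cat /= inE. Qed.

(** The descents are [T 1, ..., T k], counted from 1 whereas [x] counts from 0; [T 0] only marks the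
    start. *)
Definition exact_pattern (T : nat -> nat) k (x : nat) (b : bool) : R :=
  (b == (x.+1 \in [seq T i.+1 | i <- iota 0 k]))%:R.

(** The first term of [hessS] leaves position [T k.+1] free, which cuts off an increasing piece of
    length [m - T k.+1]; the second subtracts the case of an ascent there. The end [m] is kept in
    the free column because the induction hypothesis is used both at [m] and at [T k.+1]. *)
Lemma hess_exact_pattern T k m : T 0%N = 0%N ->
  (forall i, (i < k)%N -> (T i < T i.+1)%N) -> (T k < m)%N ->
  hess (fun i j => inv_qfact q ((T j.+1)%:Z - (T i)%:Z))
    (fun i => inv_qfact q (m%:Z - (T i)%:Z)) k = dmean (exact_pattern T k) m.-1.
Proof.
move=> T0; elim: k m => [|k IHk] m incr Tm.
  rewrite hess0 T0 subr0 /= (_ : dmean _ _ = dmean (fun _ b => (~~ b)%:R) m.-1).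
    by rewrite desc_mean_all_false // prednK //; lia.
  by apply: eq_desc_mean => x b _; rewrite /exact_pattern eqbF_neg.
have incr' i : (i < k)%N -> (T i < T i.+1)%N by move=> ik; apply: incr; lia.
have le := increasing_leq incr.
rewrite hessS => [|j jk]; last first.
  by apply: inv_qfact_lt0; have := le j.+1 k; have := incr k; lia.
have Tk := incr k (ltnSn k).
rewrite subrr /= qfact0 // invr1 mul1r !IHk //; last exact: ltn_trans Tk Tm.
case E : (T k.+1) Tk Tm => [//|a] Tk Tm.
rewrite [X in _ - X](@eq_desc_mean _ _ _ (update_at (update_at (exact_pattern T
  k) a (fun=> 1)) a (fun b => (~~ b)%:R))); last first.
  move=> x b _; rewrite /update_at; case: (x =P a) => // ->.
  rewrite /exact_pattern (_ : (_ \in _) = false) ?eqbF_neg //.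
  apply/negP => /(@in_prefix (fun i => T i.+1))[i ik].
  by have := le i.+1 k; lia.
rewrite [RHS](@eq_desc_mean _ _ _ (update_at (update_at (exact_pattern T k) a
  (fun=> 1)) a (fun b => b%:R))); last first.
  move=> x b _; rewrite /update_at /exact_pattern (in_prefixS (fun i => T
    i.+1)) E eqSS.
  by case: (x =P a) => _; rewrite ?orbT ?orbF ?eqb_id.
apply/eqP; rewrite subr_eq; apply/eqP.
have := @desc_mean_linear _ _ q_gt0 q_lt1 (update_at (exact_pattern T k) a
  (fun=> 1)) m.-1 a 1 1
  (fun b => b%:R) (fun b => (~~ b)%:R).
rewrite !mul1r => <-; first last.
- by case; rewrite /update_at eqxx /=; ring.
- by lia.
have -> : m.-1 = (a.+1 + (m - a.+2))%N by lia.
rewrite desc_mean_cut //; last by move=> b; rewrite /update_at eqxx.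
rewrite mulrC subzn; last exact: ltnW.
congr (_ * _).
  by apply: eq_desc_mean => x b xa; rewrite /update_at ltn_eqF.
rewrite /= (_ : (m - a.+1 = (m - a.+2).+1)%N); last by lia.
rewrite -desc_mean_all_false //; apply: eq_desc_mean => x b _; rewrite
  /update_at.
rewrite gtn_eqF; last by lia.
rewrite /exact_pattern (_ : (_ \in _) = false) ?eqbF_neg //.
apply/negP => /(@in_prefix (fun i => T i.+1))[i ik].
by have := le i.+1 k; lia.
Qed.

Lemma descent_set_prob n (s : seq nat) : (0 < n)%N ->
  sorted ltn s -> all (fun x => 0 < x < n)%N s ->
  let t := 0%N :: rcons s n in
  fin_prob (mallows n q)
    [set w | descent_set w == [set x : 'I_n.-1 | x.+1 \in s]] =
  \det (\matrix_(i < (size s).+1, j < (size s).+1)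
          inv_qfact q ((nth 0%N t j.+1)%:Z - (nth 0%N t i)%:Z)).
Proof.
case: n => // N _ srt bnd t.
pose T := nth 0%N (0%N :: s).
have sT : [seq T i.+1 | i <- iota 0 (size s)] = s by apply: mkseq_nth.
have incr i : (i < size s)%N -> (T i < T i.+1)%N.
  move=> si; have : sorted ltn (0%N :: s).
    case: (s) srt bnd => //= x s' -> /andP[/andP[-> _] _] //.
  by move/(sorted_ltn_nth ltn_trans 0%N) => /(_ i i.+1); apply; rewrite // inE
    /=; lia.
have Tn : (T (size s) < N.+1)%N.
  rewrite /T -[size s]/((size (0%N :: s)).-1) nth_last /=.
  case: (lastP s) bnd => [//|s' x]; rewrite all_rcons last_rcons.
  by move=> /andP[/andP[]].
rewrite (@fin_prob_desc_mean _ _ q_gt0 q_lt1 _ (exact_pattern T (size s))) =>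
  [|w].
  rewrite -(hess_exact_pattern (erefl _) incr Tn); congr (\det _).
  have tT i : (i <= size s)%N -> nth 0%N t i = T i.
    by case: i => // i si; rewrite /t /T /= nth_rcons si.
  apply/matrixP => i j; rewrite !mxE /= (tT i) -1?ltnS //.
  case: eqP => [->|/eqP js]; first by rewrite nth_rcons ltnn eqxx.
  rewrite -[nth _ _ j]/(nth 0%N t j.+1) tT //.
  by have := ltn_ord j; rewrite ltnS leq_eqVlt (negbTE js).
rewrite /exact_pattern sT prod_bool; congr (_%:R); congr nat_of_bool.
apply/eqP/forallP => [e x|e].
  by rewrite -(in_descent_set w) e inE.
by apply/setP => x; rewrite (in_descent_set w) inE (eqP (e x)).
Qed.

(* [1 - F = z (A_0 + A_1 z + ...)] with [A_i = run_coef i], so that the kernel is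
   [z^-1] times the inverse power series. *)
Definition run_coef (i : nat) : R := (-1) ^+ i * runp i.

Definition kernel : int -> R := laurent (-1) (series_inv run_coef).

(** This is Euler's second q-exponential at [-z], the classical reciprocal of the first one. *)
Definition qexp_inv : int -> R :=
  laurent 0 (fun j => (-1) ^+ j * (q ^+ 'C(j, 2) / qfact q j)).

Lemma inv_qfact_laurent : inv_qfact q = laurent 0 (fun p => (qfact q p)^-1).
Proof. by apply/funext => m; rewrite /laurent subr0. Qed.

Lemma kernel_nat (j : nat) : kernel j = series_inv run_coef j.+1.
Proof. by rewrite /kernel -(laurentE (-1)); congr laurent; lia. Qed.

Lemma run_coef0 : run_coef 0 = 1.
Proof. by rewrite /run_coef expr0 mul1r runp0. Qed.

Lemma kernelN1 : kernel (-1) = 1.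
Proof.
rewrite /kernel -[X in laurent _ _ X]addr0 (laurentE (-1) _ 0).
by rewrite series_invE big_ord0 subr0.
Qed.

Lemma kernel_lt m : m < -1 -> kernel m = 0.
Proof. exact: laurent_lt. Qed.

(* The alternating sum telescopes: its i-th term is the probability of ascents
   before position i and descents after it, which splits according to the
   status of position i. *)
Lemma qexp_conv n :
  \sum_(i < n.+1) (qfact q i)^-1 *
    ((-1) ^+ (n - i) * (q ^+ 'C(n - i, 2) / qfact q (n - i))) = (n == 0)%:R.
Proof.
case: n => [|n].
  by rewrite big_ord_recl big_ord0 /= qfact0 // !expr0 invr1 !mulr1 addr0.
pose ev c := dmean (fun x b => if (x < c)%N then (~~ b)%:R else b%:R) n.
have partial m : (m <= n)%N ->
  \sum_(i < m.+1) (-1) ^+ i * ((qfact q i)^-1 *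
     (q ^+ 'C(n.+1 - i, 2) / qfact q (n.+1 - i))) = (-1) ^+ m * ev m.
  elim: m => [_|m IHm mn].
    rewrite big_ord_recl big_ord0 addr0 subn0 qfact0 // invr1 !expr0 !mul1r.
    by rewrite /ev desc_mean_all_true.
  rewrite big_ord_recr /= IHm; last exact: ltnW.
  suff -> : (qfact q m.+1)^-1 * (q ^+ 'C(n.+1 - m.+1, 2) / qfact q (n.+1 -
    m.+1)) =
      ev m.+1 + ev m by rewrite exprS; ring.
  pose phi x b : R := if (x < m)%N then (~~ b)%:R else b%:R.
  have := @desc_mean_linear _ _ q_gt0 q_lt1 (update_at phi m (fun=> 1)) n m 1 1
    (fun b => (~~ b)%:R) (fun b => b%:R).
  rewrite !mul1r => e; rewrite /ev.
  rewrite (@eq_desc_mean _ _ (fun x b => if (x < m.+1)%N then (~~ b)%:R else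
    b%:R)
    (update_at (update_at phi m (fun=> 1)) m (fun b => (~~ b)%:R))); last first.
    by move=> x b _; rewrite /update_at /phi ltnS; case: ltngtP.
  rewrite (@eq_desc_mean _ _ (fun x b => if (x < m)%N then (~~ b)%:R else b%:R)
    (update_at (update_at phi m (fun=> 1)) m (fun b => b%:R))); last first.
    by move=> x b _; rewrite /update_at /phi; case: ltngtP.
  rewrite -e //; last by case; rewrite /update_at eqxx /=; ring.
  have en : n = (m.+1 + (n - m.+1))%N by lia.
  rewrite [in RHS]en desc_mean_cut //; last by move=> b; rewrite /update_at
    eqxx.
  congr (_ * _).
    rewrite -desc_mean_all_false //; apply: eq_desc_mean => x b xm.
    by rewrite /update_at /phi ltn_eqF // xm.
  have -> : (n.+1 - m.+1 = (n - m.+1).+1)%N by lia.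
  rewrite -/(runp _) -desc_mean_all_true //; apply: eq_desc_mean => x b _.
  by rewrite /update_at /phi gtn_eqF ?ifF //; lia.
rewrite (eq_bigr (fun i : 'I_n.+2 => (-1) ^+ n.+1 * ((-1) ^+ i * ((qfact q
  i)^-1 *
     (q ^+ 'C(n.+1 - i, 2) / qfact q (n.+1 - i)))))) => [|i _]; last first.
  have s1 : (-1) ^+ n.+1 = (-1) ^+ (n.+1 - i) * (-1) ^+ i :> R.
    by rewrite -exprD subnK // -ltnS.
  have s2 : (-1) ^+ i * (-1) ^+ i = 1 :> R by rewrite -expr2 sqrr_sign.
  by rewrite s1 -[RHS]mulrA [X in _ = _ * X]mulrA s2 mul1r mulrCA.
rewrite -big_distrr big_ord_recr /= partial // subnn qfact0 // invr1 expr0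
  !mulr1.
rewrite (_ : ev n = (qfact q n.+1)^-1); last first.
  by rewrite -desc_mean_all_false //; apply: eq_desc_mean => x b ->.
by rewrite exprS; ring.
Qed.

Lemma qexp_inverse : laurent_inverse (inv_qfact q) qexp_inv.
Proof.
rewrite inv_qfact_laurent /qexp_inv -[X in laurent X (fun j => _ * _)]oppr0.
exact/laurent_inverseP/qexp_conv.
Qed.

Lemma kernel_inverse :
  laurent_inverse (fun m => laurent_one R m - qexp_inv m) kernel.
Proof.
rewrite (_ : (fun m => _) = laurent 1 run_coef).
  by apply: laurent_inverseP => n; rewrite series_inv_conv // run_coef0.
apply/funext => m; rewrite /laurent_one /qexp_inv.
have [m0|m0|->] := ltgtP m 0.
- by rewrite !laurent_lt ?subr0 //; lia.
- have -> : m = 1 + `|m - 1|%N%:Z by lia.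
  set p := `|_|%N; rewrite laurentE (_ : 1 + p%:Z = 0 + p.+1%:Z) ?laurentE;
    last by lia.
  by rewrite exprS mulN1r mulNr sub0r opprK.
rewrite [RHS]laurent_lt // (_ : (0 : int) = 0 + 0%:Z) // laurentE.
by rewrite qfact0 // !expr0 divr1 mulr1 subrr.
Qed.

(** The product of [run_coef] and its inverse has coefficient 0 in degree [n.+1]; this is solved for
    the term with [runp n.+1]. *)
Lemma runp_rec n : runp n.+1 =
  \sum_(i < n.+1) (-1) ^+ i * kernel i * runp (n - i)%N.
Proof.
have /eqP := @series_inv_conv _ run_coef n.+1 run_coef0.
rewrite big_ord_recr /= subnn [series_inv _ 0]series_invE big_ord0 subr0 mulr1.
rewrite addrC addr_eq0 => /eqP e.
apply: (@mulfI _ ((-1) ^+ n.+1)); first by rewrite signr_eq0.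
rewrite -/(run_coef n.+1) e (reindex_inj rev_ord_inj) big_distrr -sumrN.
apply: eq_bigr => i _ /=.
have ni : (i <= n)%N by rewrite -ltnS.
rewrite subSS kernel_nat /run_coef (_ : (n.+1 - (n - i) = i.+1)%N); last by lia.
have -> : (-1) ^+ n.+1 = - ((-1) ^+ (n - i) * (-1) ^+ i) :> R.
  by rewrite -exprD subnK // exprS mulN1r.
have s2 : (-1) ^+ i * (-1) ^+ i = 1 :> R by rewrite -expr2 sqrr_sign.
transitivity (- ((-1) ^+ (n - i) * ((-1) ^+ i * (-1) ^+ i) * series_inv
  run_coef i.+1 *
  runp (n - i))); first by rewrite s2; ring.
ring.
Qed.

Section Enumeration.
Variable X : nat -> nat.

Definition present k (x : nat) (b : bool) : R :=
  if x \in [seq X i | i <- iota 0 k] then b%:R else 1.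

(** The free column belongs to a point at distance [l] beyond [X k]; [l = 0] gives the determinant
    of the kernel itself. *)
Definition khess k (l : nat) : R :=
  hess (fun i j => kernel ((X j)%:Z - (X i)%:Z))
    (fun i => kernel (l%:Z + (X k)%:Z - (X i)%:Z)) k.

(** This is the subdiagonal term of the Hessenberg recursion: the kernel is 1 at -1 and 0 below, so
    only neighbouring points contribute. *)
Definition adjacent k (l : nat) : R :=
  if k is k'.+1 then (X k == (X k').+1)%:R * khess k' l.+1 else 0.

Lemma presentS k n l : (forall i, (i < k)%N -> (X i < X i.+1)%N) -> n = (X
  k).+1 ->
  runE (present k.+1) n l = runE (present k) (X k) l.+1.
Proof.
move=> incr ->; rewrite runES // /present in_prefixS eqxx orbT /= mul0r mul0r
  add0r.
rewrite subr0 mul1r; apply: eq_runE => x b xk.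
by rewrite in_prefixS ltn_eqF ?orbF.
Qed.

Lemma present_fresh k x : (forall i, (i < k)%N -> X i != x) -> fresh (present
  k) x.
Proof.
move=> h b; rewrite /present; case: in_prefix => // -[i ik e].
by have := h i ik; rewrite e eqxx.
Qed.

Lemma khessS k l : (forall i, (i < k.+1)%N -> (X i < X i.+1)%N) ->
  khess k.+1 l = kernel l * khess k 0 - adjacent k.+1 l.
Proof.
move=> incr; have le := increasing_leq incr.
rewrite /khess hessS => [|j jk]; last first.
  apply: kernel_lt; have := le j k; have := incr k.
  by have := incr j; have := le j.+1 k; lia.
congr (_ * _ - _).
  by congr kernel; lia.
rewrite /adjacent /khess; have [e|e] := eqVneq.
  rewrite e (_ : _ - _ = -1); last by lia.
  rewrite kernelN1 !mul1r /hess; congr (\det _); apply/matrixP => i j; rewrite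
    !mxE.
  by case: ifP => // _; congr kernel; lia.
by rewrite kernel_lt ?mul0r //; have := incr k; lia.
Qed.

(** The second identity is [runp_rec] in the presence of earlier points. For [l = j = 0] the two
    right-hand sides agree, which makes [khess k 0] the probability of descents at [X 0, ..., X k].
    All [l] and [j] are needed because, next to [X k], a run at [X k.+1] is a longer run at
    [X k]. *)
Lemma khess_run k : (forall i, (i < k)%N -> (X i < X i.+1)%N) ->
  (forall l, khess k l = kernel l * runE (present k) (X k) 0 - adjacent k l) /\
  (forall j, runE (present k) (X k) j.+1 =
     \sum_(i < j.+1) (-1) ^+ i * kernel i * runE (present k) (X k) (j - i) +
     (-1) ^+ j.+1 * adjacent k j).
Proof.
elim: k => [|k IHk] incr.
  have e l : runE (present 0) (X 0) l = runp l.
    case: (X 0%N) => [|x]; first by rewrite run0E.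
    rewrite runE_fresh //.
    by rewrite (@desc_mean_fresh_tail _ _ _ _ _ 0) ?desc_mean0 ?mul1r.
  split=> [l|j].
    rewrite e runp0 // mulr1 subr0 /khess hess0; congr kernel; lia.
  by rewrite /= mulr0 addr0 e runp_rec; apply: eq_bigr => i _; rewrite e.
have incr' i : (i < k)%N -> (X i < X i.+1)%N by move=> ik; apply: incr; lia.
have le := increasing_leq incr.
have [IH1 IH2] := IHk incr'.
have Xk := incr k (ltnSn k).
have Dk : khess k 0 = runE (present k.+1) (X k.+1) 0.
  rewrite [RHS]runE0 (@desc_mean_fresh_tail _ _ _ _ _ (X k).+1) //.
    by rewrite -runE0 presentS // IH2 IH1 big_ord1 expr0 mul1r mulN1r subnn.
  move=> x xk; apply: present_fresh => i ik.
  by have := le i k; lia.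
split=> [l|j]; first by rewrite khessS // Dk.
have [adj|nadj] := eqVneq (X k.+1) (X k).+1.
  (* Neighbours: in [IH2] at [j.+1], the last summand and the correction combine into
     [khess k j.+1]. *)
  rewrite /= adj eqxx mul1r presentS // IH2 big_ord_recr /= subnn.
  rewrite IH1 -addrA; congr (_ + _).
    apply: eq_bigr => i _; rewrite presentS //; congr (_ * runE _ _ _).
    by have := ltn_ord i; lia.
  by rewrite !exprS; ring.
(* Otherwise the position just before [X k.+1] is free and the run splits off. *)
rewrite /= (negbTE nadj) mul0r mulr0 addr0.
case E : (X k.+1) => [|x]; first by rewrite E in Xk.
have fr : fresh (present k.+1) x.
  apply: present_fresh => i ik; have := le i k; lia.
rewrite runE_fresh // runp_rec big_distrr; apply: eq_bigr => i _ /=.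
by rewrite runE_fresh // mulrCA.
Qed.

Lemma khess_desc_mean k n : (forall i, (i < k)%N -> (X i < X i.+1)%N) -> (X k <
  n)%N ->
  khess k 0 = dmean (present k.+1) n.
Proof.
move=> incr Xn; have [IH1 IH2] := khess_run incr; have le := increasing_leq
  incr.
rewrite (@desc_mean_fresh_tail _ _ _ _ _ (X k).+1) //.
  by rewrite -runE0 presentS // IH2 IH1 big_ord1 expr0 mul1r mulN1r subnn.
move=> x xk; apply: present_fresh => i ik.
by have := le i k; lia.
Qed.

Lemma det_kernel n N : (forall i, (i.+1 < n)%N -> (X i < X i.+1)%N) ->
  (forall i, (i < n)%N -> (X i < N)%N) ->
  \det (\matrix_(i < n, j < n) kernel ((X j)%:Z - (X i)%:Z)) =
  dmean (present n) N.
Proof.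
case: n => [|k] incr XN.
  by rewrite det_mx00 (@desc_mean_fresh_tail _ _ _ _ _ 0) ?desc_mean0.
rewrite -khess_desc_mean //; last exact: XN.
rewrite /khess /hess; congr (\det _); apply/matrixP => i j; rewrite !mxE.
by rewrite add0r; case: eqP => [->|].
Qed.

End Enumeration.

Lemma sorted_enum_val M (A : {set 'I_M}) : sorted ltn (map val (enum A)).
Proof.
have h : sorted (relpre val ltn) (enum 'I_M).
  by rewrite -sorted_map val_enum_ord iota_ltn_sorted.
have -> : enum A = [seq x <- enum 'I_M | x \in A] by rewrite enumT.
rewrite sorted_map; apply: (sorted_filter _ _ h) => x y z /=; exact: ltn_trans.
Qed.

Lemma process_determinantal N :
  determinantal (descent_process N.+1 q) (fun x y => kernel (y%:Z - x%:Z)).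
Proof.
rewrite /determinantal /= => A; rewrite correlationE //.
pose X := nth 0%N (map val (enum A)).
have szA : size (map val (enum A)) = #|A| by rewrite size_map -cardE.
have XE (i : 'I_#|A|) : X i = enum_val i.
  have x0 := enum_val i.
  by rewrite (enum_val_nth x0) /X (nth_map x0) // -cardE.
have srt := sorted_enum_val A.
have memX x : (x \in [seq X i | i <- iota 0 #|A|]) = memn A x.
  by rewrite /memn -[in RHS](mkseq_nth 0%N (map val (enum A))) szA.
transitivity (dmean (present X #|A|) N).
  apply: eq_desc_mean => x b _; rewrite /pattern /present memX.
  by case: (memn A x); rewrite ?eqb_id.
rewrite -det_kernel => [|i iA|i iA].
- by congr (\det _); apply/matrixP => i j; rewrite !mxE !XE.
- by apply: (sorted_ltn_nth ltn_trans 0%N srt); rewrite ?inE ?szA // ltnW.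
by rewrite (XE (Ordinal iA)).
Qed.

End DescentDeterminants.

(** * Stein's equation for the normal law *)

Import numFieldNormedType.Exports.

Section RealCalculus.
Variable R : realType.
Implicit Types (f g df : R -> R) (x y a b : R).

Lemma is_derive_add f g x a b : is_derive x 1 f a -> is_derive x 1 g b ->
  is_derive x 1 (fun y => f y + g y) (a + b).
Proof. by move=> ? ?; apply: is_deriveD. Qed.

Lemma is_derive_sub f g x a b : is_derive x 1 f a -> is_derive x 1 g b ->
  is_derive x 1 (fun y => f y - g y) (a - b).
Proof. by move=> ? ?; apply: is_deriveB. Qed.

Lemma is_derive_mul f g x a b : is_derive x 1 f a -> is_derive x 1 g b ->
  is_derive x 1 (fun y => f y * g y) (f x * b + g x * a).
Proof. by move=> ? ?; apply: is_deriveM. Qed.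

Lemma is_derive_scale f x a k : is_derive x 1 f a ->
  is_derive x 1 (fun y => k * f y) (k * a).
Proof. by move=> ?; apply: is_deriveZ. Qed.

Lemma is_derive_inv f x a : f x != 0 -> is_derive x 1 f a ->
  is_derive x 1 (fun y => (f y)^-1) (- a / f x ^+ 2).
Proof.
move=> fx0 fa; apply: is_derive_eq (is_deriveV fx0 fa) _.
by rewrite /GRing.scale /= mulNr mulrC mulNr.
Qed.

Lemma is_derive_continuous f x a : is_derive x 1 f a -> {for x, continuous f}.
Proof.
by move=> fa; apply/differentiable_continuous/derivable1_diffP; exact:
  ex_derive.
Qed.

Lemma mean_value f df a b : (forall x, is_derive x 1 f (df x)) ->
  exists2 c, `|c - a| <= `|b - a| & f b - f a = df c * (b - a).
Proof.
move=> fdf; have cont u v : {within `[u, v], continuous f}%classic.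
  by apply: continuous_subspaceT => x; apply: is_derive_continuous (fdf x).
have [ab|/ltW ba] := leP a b.
  have [c cab e] := MVT_segment ab (fun x _ => fdf x) (cont _ _).
  exists c => //; move: cab; rewrite in_itv /= => /andP[ac cb].
  by rewrite !ger0_norm ?subr_ge0 // lerD2r.
have [c cab e] := MVT_segment ba (fun x _ => fdf x) (cont _ _).
exists c; last by rewrite -(opprB a b) mulrN -e opprB.
move: cab; rewrite in_itv /= => /andP[bc ca].
by rewrite !ler0_norm ?subr_le0 // lerN2 lerD2r.
Qed.

Lemma mean_value_le f df a b : a <= b -> (forall x, a <= x -> is_derive x 1 f
  (df x)) ->
  exists2 c, a <= c <= b & f b - f a = df c * (b - a).
Proof.
move=> ab fdf.
have [x /andP[ax _]||c cab e] := @MVT_segment _ f df a b ab.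
- by apply: fdf; apply: ltW.
- apply: continuous_in_subspaceT => x; rewrite inE /= in_itv /= => /andP[ax _].
  exact: is_derive_continuous (fdf x ax).
- by exists c; rewrite // -in_itv.
Qed.

(** If [f a < 0], monotonicity keeps [f] below [f a], so it cannot exceed [f a / 2] later on. This
    serves for inequalities that become equalities at infinity. *)
Lemma antitone_tail_ge0 f df a : (forall x, a <= x -> is_derive x 1 f (df x)) ->
  (forall x, a <= x -> df x <= 0) ->
  (forall e, 0 < e -> exists2 y, a <= y & - e <= f y) -> 0 <= f a.
Proof.
move=> fdf df0 tail; rewrite leNgt; apply/negP => fa0.
have [y ay fy] := tail (- f a / 2) ltac:(by rewrite divr_gt0 // oppr_gt0).
have [c /andP[ac _] e] := mean_value_le ay fdf.
have : df c * (y - a) <= 0 by rewrite mulr_le0_ge0 ?df0 // subr_ge0.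
by rewrite -e; lra.
Qed.

Lemma continuous_bounded f a b : continuous f -> 
  exists C, forall x, a <= x <= b -> `|f x| <= C.
Proof.
move=> cf; have [ab|ba] := leP a b; last first.
  by exists 0 => x /andP[ax xb]; have := lt_le_trans ba (le_trans ax xb);
    rewrite ltxx.
have [|c _ H] := @EVT_max _ (fun x => `|f x|) a b ab.
  by apply: continuous_subspaceT => x; apply: cvg_norm; apply: cf.
by exists `|f c| => x xab; apply: H; rewrite in_itv.
Qed.

(* Gluing at s: the derivative of g vanishes there, so freezing the argument
   beyond s preserves differentiability. *)
Lemma is_derive_frozen g dg s x : (forall x, is_derive x 1 g (dg x)) -> dg s =
  0 ->
  is_derive x 1 (fun y => g (Num.min y s)) (dg (Num.min x s)).
Proof.
move=> gdg dgs; have [xs|sx|xs] := ltgtP x s.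
- apply: near_eq_is_derive (gdg x).
  by apply: filterS (lt_nbhsl xs) => y ys; rewrite min_l // ltW.
- rewrite dgs.
  apply: near_eq_is_derive (is_derive_cst (g s) x 1).
  by apply: filterS (lt_nbhsr sx) => y ys; rewrite min_r // ltW.
rewrite xs ?minxx dgs.
have p0 : (h^-1 *: ((g \o shift s) (h *: 1) - g s) @[h --> 0^'] --> (0 :
  R))%classic.
  have := @ex_derive _ _ _ _ _ _ _ (gdg s).
  by rewrite /derivable -/('D_1 g s) (@derive_val _ _ _ _ _ _ _ (gdg s)) dgs.
have q0 : (h^-1 *: (((fun y => g (Num.min y s)) \o shift s) (h *: 1) -
    g (Num.min s s)) @[h --> 0^'] --> (0 : R))%classic.
  apply/cvgr0Pnorm_le => e e0.
  have H := (cvgr0Pnorm_le _).1 p0 e e0.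
  near=> h; apply: (@le_trans _ _ `|h^-1 *: ((g \o shift s) (h *: 1) - g s)|);
    last first.
    by near: h; exact: H.
  rewrite !normrZ ler_wpM2l // minxx /shift /=.
  by have [_|_] := leP (h *: 1 + s) s; rewrite ?subrr ?normr0.
apply: DeriveDef; first by apply/cvg_ex; exists 0.
exact: cvg_lim q0.
Unshelve. all: by end_near. Qed.

End RealCalculus.

(** * The normal density, its distribution function and the Mills ratio *)

Section StandardNormal.
Variable R : realType.
Implicit Types (x y t e : R).

Definition gpdf (x : R) : R := normal_pdf 0 1 x.
Definition gcdf (x : R) : R := fine (normal_prob 0 1 `]-oo, x]%classic).

Lemma gpdfE x : gpdf x = normal_peak 1 * expR (- (x ^+ 2 / 2)).
Proof.
rewrite /gpdf normal_pdfE ?oner_neq0 // /normal_fun subr0 expr1n; congr (_ *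
  expR _).
by rewrite mulNr -mulr_natr mul1r.
Qed.

Lemma gpdf_gt0 x : 0 < gpdf x.
Proof. by rewrite gpdfE mulr_gt0 ?expR_gt0 // normal_peak_gt0 // oner_neq0. Qed.

Lemma gpdf_neq0 x : gpdf x != 0.
Proof. by rewrite gt_eqF // gpdf_gt0. Qed.

Lemma gpdfN x : gpdf (- x) = gpdf x.
Proof. by rewrite !gpdfE sqrrN. Qed.

Lemma gpdf_ub x : gpdf x <= normal_peak 1.
Proof. by apply: normal_pdf_ub; exact: oner_neq0. Qed.

Lemma is_derive_gpdf x : is_derive x 1 gpdf (- x * gpdf x).
Proof.
have -> : gpdf = (fun y => normal_peak 1 * (expR \o (fun y => - (2^-1 * (y *
  y)))) y).
  by apply/funext => y; rewrite gpdfE /= expr2 mulrC [2^-1 * _]mulrC mulrC.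
have d : is_derive x 1 (fun y => - (2^-1 * (y * y))) (- (2^-1 * (x * 1 + x *
  1))).
  by apply: is_deriveN; apply: is_derive_scale; apply: is_derive_mul.
apply: is_derive_eq (is_derive_scale _ (is_derive1_comp (is_derive_expR _) d))
  _.
by rewrite /=; field.
Qed.

Lemma is_derive_gcdf x : is_derive x 1 gcdf (gpdf x).
Proof.
have x1 : x < x + 1 by rewrite ltrDl.
have [||d1 d2] := @continuous_FTC1 R gpdf -oo%O x (x + 1) x1 _ (ltNyr _) _.
- by apply: integrableS (integrable_normal_pdf 0 1).
- exact: is_derive_continuous (is_derive_gpdf x).
by apply: DeriveDef; [exact: d1|rewrite -derive1E; exact: d2].
Qed.

Lemma gcdf_prob x : normal_prob 0 1 `]-oo, x]%classic = (gcdf x)%:E.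
Proof. by rewrite /gcdf fineK // fin_num_measure. Qed.

Lemma gcdf_ge0 x : 0 <= gcdf x.
Proof. by rewrite -lee_fin -gcdf_prob. Qed.

Lemma gcdf_le1 x : gcdf x <= 1.
Proof. by rewrite -lee_fin -gcdf_prob; apply: probability_le1. Qed.

Lemma gcdf_incr x y : x <= y -> gcdf x <= gcdf y.
Proof.
move=> xy; rewrite -lee_fin -!gcdf_prob le_measure ?inE //.
by apply: subset_itvl; rewrite bnd_simp.
Qed.

Let idRV : measurableTypeR R -> R := idfun.

#[local] HB.instance Definition _ :=
  @isMeasurableFun.Build _ _ _ _ idRV (@measurable_id _ _ setT).

Lemma cvg_gcdfy : (gcdf x @[x --> +oo] --> (1 : R))%classic.
Proof.
have := @cvg_cdfy1 _ _ _ (normal_prob 0 1) (idRV : {RV (normal_prob 0 1) >->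
  R}).
by move/fine_cvg.
Qed.

Lemma cvg_gcdfNy : (gcdf x @[x --> -oo] --> (0 : R))%classic.
Proof.
have := @cvg_cdfNy0 _ _ _ (normal_prob 0 1) (idRV : {RV (normal_prob 0 1) >->
  R}).
by move/fine_cvg.
Qed.

Lemma gcdf_tail e a : 0 < e -> exists2 y, a <= y & 1 - e <= gcdf y.
Proof.
move=> e0; have H := (cvgrPdist_le _ _).1 cvg_gcdfy e e0.
near (pinfty_nbhs R)%R => y; exists y.
  by near: y; apply: nbhs_pinfty_ge; apply: num_real.
have : `|1 - gcdf y| <= e by near: y; exact: H.
by rewrite ler_norml => /andP[]; lra.
Unshelve. all: by end_near. Qed.

(** The density is even, so [gcdf y + gcdf (- y)] is constant; its value is read off at infinity. *)
Lemma gcdfN x : gcdf (- x) = 1 - gcdf x.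
Proof.
pose s y := gcdf y + gcdf (- y).
have s0 y : is_derive y 1 s 0.
  have dN : is_derive y 1 (fun y : R => - y) (-1) by apply: is_deriveNid.
  apply: is_derive_eq (is_derive_add (is_derive_gcdf y)
    (is_derive1_comp (is_derive_gcdf (- y)) dN)) _.
  by rewrite gpdfN mulrN1 subrr.
suff : s x = 1 by rewrite /s; lra.
have s1 y : s y = s x by apply: is_derive_0_is_cst.
have sy : (s y @[y --> +oo] --> (1 + 0 : R))%classic.
  apply: cvgD; first exact: cvg_gcdfy.
  by have := cvg_gcdfNy; rewrite cvgNy_compNP.
have sx : (s y @[y --> +oo] --> s x)%classic.
  by rewrite (_ : s = cst (s x)); [exact: cvg_cst|apply/funext].
by rewrite (cvg_unique _ sx sy) // addr0.
Qed.

Lemma mills_ub x : 0 < x -> x * (1 - gcdf x) <= gpdf x.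
Proof.
move=> x0; pose D y := gpdf y * y^-1 - (1 - gcdf y).
suff : 0 <= D x by rewrite /D subr_ge0 ler_pdivlMr // mulrC.
pose dD y := gpdf y * (- 1 / y ^+ 2) + y^-1 * (- y * gpdf y) - (0 - gpdf y).
apply: (@antitone_tail_ge0 _ _ dD) => [y xy|y xy|e e0].
- have y0 : y != 0 by rewrite gt_eqF // (lt_le_trans x0).
  apply: is_derive_sub.
    apply: is_derive_mul; first exact: is_derive_gpdf.
    exact: is_derive_inv.
  by apply: is_derive_sub; exact: is_derive_gcdf.
- have y0 : 0 < y by apply: lt_le_trans xy.
  have -> : dD y = - (gpdf y / y ^+ 2) by rewrite /dD; field; rewrite gt_eqF.
  by rewrite oppr_le0 divr_ge0 ?exprn_ge0 // ltW // gpdf_gt0.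
have [y xy ey] := gcdf_tail x e0; exists y => //.
have : 0 <= gpdf y * y^-1.
  by rewrite mulr_ge0 ?invr_ge0 ?(le_trans _ xy) // ltW // gpdf_gt0.
by rewrite /D; lra.
Qed.

(** Together with [mills_ub] this encloses the Mills ratio [M] tightly enough for [x - x^2 M] to
    stay bounded as [x] grows. *)
Lemma mills_lb x : x * gpdf x <= (1 + x ^+ 2) * (1 - gcdf x).
Proof.
have pos y : 0 < 1 + y * y by rewrite ltr_wpDr // -expr2 sqr_ge0.
pose D y := 1 - gcdf y - y * gpdf y * (1 + y * y)^-1.
suff : 0 <= D x.
  by rewrite /D subr_ge0 ler_pdivrMr ?pos // expr2 [_ * (1 - _)]mulrC.
pose dD y := 0 - gpdf y -
  (y * gpdf y * (- (0 + (y * 1 + y * 1)) / (1 + y * y) ^+ 2) +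
   (1 + y * y)^-1 * (y * (- y * gpdf y) + gpdf y * 1)).
apply: (@antitone_tail_ge0 _ _ dD) => [y xy|y xy|e e0].
- apply: is_derive_sub.
    by apply: is_derive_sub; exact: is_derive_gcdf.
  apply: is_derive_mul; first by apply: is_derive_mul; exact: is_derive_gpdf.
  by apply: is_derive_inv; rewrite gt_eqF.
- have -> : dD y = - (2 * gpdf y / (1 + y * y) ^+ 2).
    by rewrite /dD; field; rewrite gt_eqF.
  by rewrite oppr_le0 divr_ge0 ?exprn_ge0 ?mulr_ge0 // ltW // gpdf_gt0.
(* From [normal_peak 1 / e] on, the density is at most [e * y], so the subtracted term is at most
   [e]. *)
pose y := Num.max x (normal_peak 1 / e); exists y; first by rewrite le_max lexx.
have K0 : 0 < normal_peak 1 :> R by rewrite normal_peak_gt0 // oner_neq0.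
have y0 : 0 < y by rewrite lt_max divr_gt0 ?orbT.
have ye : normal_peak 1 <= e * y by rewrite mulrC -ler_pdivrMr // le_max lexx
  orbT.
have : y * gpdf y * (1 + y * y)^-1 <= e.
  rewrite ler_pdivrMr ?pos //.
  apply: (@le_trans _ _ (y * (e * y))).
    by rewrite ler_pM2l // (le_trans (gpdf_ub y)).
  by nra.
by have := gcdf_le1 y; rewrite /D; lra.
Qed.

End StandardNormal.

(** * The smoothed indicator and its Stein solution *)

Section SteinSolution.
Variables (R : realType) (t e : R).
Hypothesis e_gt0 : 0 < e.
Implicit Types (x y s : R).

Let te_gt : t < t + e. Proof. by rewrite ltrDl. Qed.

Let e_neq0 : e != 0. Proof. by rewrite gt_eqF. Qed.

Definition ramp s x : R := s - Num.min x s.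

Lemma ramp_l s x : x <= s -> ramp s x = s - x.
Proof. by move=> xs; rewrite /ramp min_l. Qed.

Lemma ramp_r s x : s <= x -> ramp s x = 0.
Proof. by move=> xs; rewrite /ramp min_r // subrr. Qed.

Lemma ramp_lipschitz s x y : `|ramp s x - ramp s y| <= `|x - y|.
Proof.
rewrite /ramp; case: (leP x s) => xs; case: (leP y s) => ys;
  rewrite ler_norml; have := ler_norm (x - y); have := ler_norm (y - x);
  rewrite (distrC y x); move=> h1 h2; apply/andP; split; lra.
Qed.

(* The continuous test function equal to 1 up to t, to 0 from t + e on, and
   affine in between. *)
Definition plateau x : R := (ramp (t + e) x - ramp t x) / e.

Lemma plateau_l x : x <= t -> plateau x = 1.
Proof.
move=> xt; rewrite /plateau !ramp_l ?(le_trans xt) ?(ltW te_gt) //.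
by rewrite (_ : _ - _ = e) ?divff //; ring.
Qed.

Lemma plateau_r x : t + e <= x -> plateau x = 0.
Proof.
move=> xt; rewrite /plateau !ramp_r ?subrr ?mul0r //.
by apply: le_trans xt; apply: ltW.
Qed.

Lemma plateau_bounds x : 0 <= plateau x <= 1.
Proof.
rewrite /plateau ler_pdivrMr // mul1r divr_ge0 ?(ltW e_gt0) //=.
  have te := te_gt; have [xt|tx] := leP x t.
    by rewrite !ramp_l //; lra.
  rewrite (ramp_r (ltW tx)); have [xt|tx'] := leP x (t + e).
    by rewrite ramp_l //; lra.
  by rewrite (ramp_r (ltW tx')); lra.
have te := te_gt; have [xt|tx] := leP x t.
  by rewrite !ramp_l //; lra.
rewrite (ramp_r (ltW tx)); have [xt|tx'] := leP x (t + e).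
  by rewrite ramp_l //; lra.
by rewrite (ramp_r (ltW tx')); lra.
Qed.

Definition gcdf_prim x : R := x * gcdf x + gpdf x.

Lemma is_derive_gcdf_prim x : is_derive x 1 gcdf_prim (gcdf x).
Proof.
apply: is_derive_eq (is_derive_add (is_derive_mul (is_derive_id x 1)
  (is_derive_gcdf x)) (is_derive_gpdf x)) _.
by rewrite /=; ring.
Qed.

(* The mean of [plateau] under the standard normal law. *)
Definition plateau_mean : R := (gcdf_prim (t + e) - gcdf_prim t) / e.

Lemma plateau_mean_bounds : gcdf t <= plateau_mean <= gcdf (t + e).
Proof.
have [c /andP[tc ct] E] := mean_value_le (ltW te_gt) (fun x _ =>
  is_derive_gcdf_prim x).
by rewrite /plateau_mean E [_ - t]addrC addKr mulfK // !gcdf_incr.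
Qed.

Let c_ge0 : 0 <= plateau_mean.
Proof. by have /andP[h _] := plateau_mean_bounds; apply: le_trans h; apply:
  gcdf_ge0. Qed.

Let c_le1 : plateau_mean <= 1.
Proof. by have /andP[_ h] := plateau_mean_bounds; apply: le_trans h _; apply:
  gcdf_le1. Qed.

(* A primitive of (s - x) * gpdf x up to s, constant from s on. *)
Definition ramp_prim s x : R :=
  s * gcdf (Num.min x s) + gpdf (Num.min x s).

Lemma is_derive_ramp_prim s x : is_derive x 1 (ramp_prim s) (ramp s x * gpdf x).
Proof.
have d y : is_derive y 1 (fun z => s * gcdf z + gpdf z) ((s - y) * gpdf y).
  apply: is_derive_eq (is_derive_add (is_derive_scale s (is_derive_gcdf y))
    (is_derive_gpdf y)) _.
  by ring.
have ds : (s - s) * gpdf s = 0 by rewrite subrr mul0r.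
apply: is_derive_eq (is_derive_frozen x d ds) _.
rewrite /ramp; have [xs|sx] := leP x s; first by [].
by rewrite subrr !mul0r.
Qed.

(** This is the integral of [(plateau - plateau_mean) * gpdf] from minus infinity to [x]. *)
Definition stein_num x : R :=
  e^-1 * (ramp_prim (t + e) x - ramp_prim t x) - plateau_mean * gcdf x.

Definition stein_sol x : R := stein_num x * (gpdf x)^-1.

Definition stein_der x : R := x * stein_sol x + plateau x - plateau_mean.

Lemma is_derive_stein x : is_derive x 1 stein_sol (stein_der x).
Proof.
have d1 := is_derive_sub (is_derive_scale e^-1
  (is_derive_sub (is_derive_ramp_prim (t + e) x) (is_derive_ramp_prim t x)))
  (is_derive_scale plateau_mean (is_derive_gcdf x)).
have d2 := is_derive_inv (gpdf_neq0 x) (is_derive_gpdf x).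
apply: is_derive_eq (is_derive_mul d1 d2) _.
rewrite /stein_der /stein_sol /plateau -/(stein_num x); have := gpdf_neq0 x.
by move=> g0; field; rewrite g0 e_neq0.
Qed.

Lemma stein_l x : x <= t ->
  stein_sol x = (1 - plateau_mean) * (gcdf x / gpdf x).
Proof.
move=> xt; have xte : x <= t + e by rewrite (le_trans xt) // ltW.
rewrite /stein_sol /stein_num /ramp_prim !min_l //.
by have := gpdf_neq0 x => g0; field; rewrite g0 e_neq0.
Qed.

Lemma stein_r x : t + e <= x ->
  stein_sol x = plateau_mean * ((1 - gcdf x) / gpdf x).
Proof.
move=> xt; have xt' : t <= x by apply: le_trans xt; apply: ltW.
rewrite /stein_sol /stein_num /ramp_prim !min_r //.
rewrite -/(gcdf_prim _) -/(gcdf_prim _) [e^-1 * _]mulrC -/plateau_mean; ring.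
Qed.

(** With [M] the ratio, [mills_ub] gives [x M <= 1] and [mills_lb] gives [x - x^2 M <= M <= 1]. *)
Let mills x : 1 <= x -> [/\ 0 <= (1 - gcdf x) / gpdf x <= 1,
  0 <= 1 - x * ((1 - gcdf x) / gpdf x) <= 1 &
  `|x * (1 - x * ((1 - gcdf x) / gpdf x))| <= 1].
Proof.
move=> x1; have x0 : 0 < x by apply: lt_le_trans x1.
set M := _ / _.
have M0 : 0 <= M by rewrite divr_ge0 ?subr_ge0 ?gcdf_le1 // ltW // gpdf_gt0.
have h1 : x * M <= 1 by rewrite mulrA ler_pdivrMr ?gpdf_gt0 // mul1r mills_ub.
have h2 : x <= (1 + x ^+ 2) * M.
  by rewrite mulrA ler_pdivlMr ?gpdf_gt0 // mills_lb.
have h3 : 0 <= x * M by rewrite mulr_ge0 // ltW.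
split; first by nra.
  by apply/andP; split; lra.
by rewrite ger0_norm; nra.
Qed.

(** In each tail the solution is a Mills ratio times a factor in [0, 1], whence the bound 1 there;
    in between, continuity on a segment suffices. [C] need not be explicit, since [t] and [e] are
    fixed before [N] grows. *)
Lemma stein_bounded : exists2 C : R, 0 <= C & forall x,
  [/\ `|stein_sol x| <= C, `|stein_der x| <= C & `|x * stein_der x| <= C].
Proof.
pose a := Num.min t (-1); pose b := Num.max (t + e) 1.
have cont : continuous stein_sol.
  by move=> x; apply: is_derive_continuous (is_derive_stein x).
have [C0 HC] := continuous_bounded a b cont.
pose B := `|a| + `|b|; pose C1 := `|C0|.
have C1_ge0 : 0 <= C1 by rewrite normr_ge0.
have B_ge0 : 0 <= B by rewrite addr_ge0.
have P1 : 0 <= B * C1 by rewrite mulr_ge0.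
have P2 : 0 <= B * (B * C1 + 2) by rewrite mulr_ge0 // addr_ge0.
pose C := C1 + (B * C1 + 2) + B * (B * C1 + 2) + 1.
have C_ge1 : 1 <= C by rewrite /C; lra.
exists C; first exact: le_trans C_ge1.
have scale (k u : R) : 0 <= k <= 1 -> `|u| <= 1 -> `|k * u| <= 1.
  move=> /andP[k0 k1] u1; rewrite normrM ger0_norm //.
  by rewrite -[leRHS]mulr1 ler_pM.
move=> x; have [xa|ax] := leP x a.
  have [xt x1] : x <= t /\ x <= -1 by move: xa; rewrite le_min => /andP.
  have y1 : 1 <= - x by lra.
  have [] := mills y1; rewrite gcdfN gpdfN opprB addrC subrK.
  set M := _ / _ => M01 N01 xN1.
  have kk : 0 <= 1 - plateau_mean <= 1.
    by rewrite subr_ge0 c_le1 /= gerBl c_ge0.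
  have sE : stein_sol x = (1 - plateau_mean) * M by rewrite stein_l.
  have dE : stein_der x = (1 - plateau_mean) * (1 - - x * M).
    by rewrite /stein_der sE plateau_l //; ring.
  have xdE : x * stein_der x = - ((1 - plateau_mean) * (- x * (1 - - x * M))).
    by rewrite dE; ring.
  have M1 : `|M| <= 1 by case/andP: M01 => ? ?; rewrite ger0_norm.
  have N1 : `|1 - - x * M| <= 1 by case/andP: N01 => ? ?; rewrite ger0_norm.
  by rewrite xdE normrN sE dE; split; apply: le_trans C_ge1; exact: scale.
have [bx|xb] := leP b x.
  have [xt x1] : t + e <= x /\ 1 <= x by move: bx; rewrite ge_max => /andP.
  have [] := mills x1; set M := _ / _ => M01 N01 xN1.
  have kk : 0 <= plateau_mean <= 1 by rewrite c_ge0 c_le1.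
  have sE : stein_sol x = plateau_mean * M by rewrite stein_r.
  have dE : stein_der x = - (plateau_mean * (1 - x * M)).
    by rewrite /stein_der sE plateau_r //; ring.
  have xdE : x * stein_der x = - (plateau_mean * (x * (1 - x * M))).
    by rewrite dE; ring.
  have M1 : `|M| <= 1 by case/andP: M01 => ? ?; rewrite ger0_norm.
  have N1 : `|1 - x * M| <= 1 by case/andP: N01 => ? ?; rewrite ger0_norm.
  by rewrite xdE !normrN sE dE normrN; split; apply: le_trans C_ge1; exact:
    scale.
have fx : `|stein_sol x| <= C1.
  by apply: le_trans (ler_norm C0); apply: HC; rewrite !ltW.
have xB : `|x| <= B.
  rewrite /B ler_norml; have := ler_norm b; have := ler_norm (- a).
  have := normr_ge0 a; have := normr_ge0 b.
  by rewrite normrN => h1 h2 h3 h4; apply/andP; split; lra.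
have gx : `|stein_der x| <= B * C1 + 2.
  have -> : stein_der x = x * stein_sol x + (plateau x - plateau_mean).
    by rewrite /stein_der addrA.
  apply: le_trans (ler_normD _ _) _; apply: lerD.
    by rewrite normrM ler_pM.
  have /andP[h1 h2] := plateau_bounds x; have h3 := c_ge0; have h4 := c_le1.
  rewrite ler_norml.
  by apply/andP; split; lra.
rewrite /C; split; [lra|lra|].
rewrite normrM; apply: (@le_trans _ _ (B * (B * C1 + 2))); last lra.
by rewrite ler_pM.
Qed.

(** [plateau] has kinks, so the mean value theorem is applied only to [x * stein_sol x], whose
    derivative is at most [2 * C]; the two ramps contribute the crude slope [2 / e]. *)
Lemma stein_lipschitz : exists2 L : R, 0 <= L &
  (forall x, `|stein_der x| <= L) /\
  (forall x y, `|stein_der x - stein_der y| <= L * `|x - y|).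
Proof.
have [C C0 HC] := stein_bounded.
have ie : 0 < e^-1 by rewrite invr_gt0.
exists (2 * C + 2 / e); first by rewrite addr_ge0 ?mulr_ge0 // ltW.
split=> [x|x y].
  have [_ h _] := HC x; apply: le_trans h _.
  by have : 0 <= 2 / e; [rewrite mulr_ge0 // ltW|lra].
have -> : stein_der x - stein_der y =
    (x * stein_sol x - y * stein_sol y) + (plateau x - plateau y).
  by rewrite /stein_der; ring.
apply: le_trans (ler_normD _ _) _; rewrite mulrDl; apply: lerD.
  have d (z : R) : is_derive z 1 (fun u : R => u * stein_sol u) (z * stein_der
    z + stein_sol z * 1).
    by apply: is_derive_mul; exact: is_derive_stein.
  have [c _ ->] := mean_value y x d; rewrite normrM ler_wpM2r // mulr1.
  have [h1 _ h3] := HC c; apply: le_trans (ler_normD _ _) _.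
  by have := lerD h3 h1; lra.
have -> : plateau x - plateau y =
    e^-1 * ((ramp (t + e) x - ramp (t + e) y) - (ramp t x - ramp t y)).
  by rewrite /plateau; ring.
rewrite normrM (gtr0_norm ie) [2 / e]mulrC -mulrA ler_pM2l //.
apply: le_trans (ler_normB _ _) _.
by have := lerD (ramp_lipschitz (t + e) x y) (ramp_lipschitz t x y); lra.
Qed.

End SteinSolution.

(** * Stein's method under local dependence *)

Section Near.
Variable N : nat.

Definition near_ord (r : nat) (i j : 'I_N) : bool := (i <= j + r)%N && (j <= i
  + r)%N.

Lemma near_ordPn r (i j : 'I_N) : ~~ near_ord r i j -> r.+1%:Z <= `|i%:Z -
  j%:Z|.
Proof. rewrite /near_ord; lia. Qed.

Lemma sum_near (R : realType) r i : \sum_(j < N) (near_ord r i j)%:R <= (2 * r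
  + 1)%:R :> R.
Proof.
rewrite -natr_sum ler_nat.
have -> : (\sum_(j < N) near_ord r i j = #|[pred j | near_ord r i j]|)%N.
  by rewrite -sum1_card [RHS]big_mkcond; apply: eq_bigr => j _; rewrite inE;
    case: ifP.
rewrite cardE -(size_map val) -[leqRHS](size_iota (i - r)).
apply: uniq_leq_size.
  by rewrite map_inj_uniq ?enum_uniq //; exact: val_inj.
move=> x /mapP[j]; rewrite mem_enum inE /near_ord mem_iota => ij ->.
by rewrite -[val j]/(nat_of_ord j); move: ij; lia.
Qed.

End Near.

Section LocalDependence.
Variables (R : realType) (T : finType) (P : T -> R) (N : nat) (D : T -> {set
  'I_N}).
Hypothesis P_dist : is_distribution P.
Hypothesis indep : forall (X Y : {set 'I_N}) (g h : {set 'I_N} -> R), far X Y ->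
  fin_mean P (fun w => g (D w :&: X) * h (D w :&: Y)) =
  fin_mean P (fun w => g (D w :&: X)) * fin_mean P (fun w => h (D w :&: Y)).
Variables p s : R.
Hypotheses (p01 : 0 <= p <= 1) (s_gt0 : 0 < s).
Hypothesis mean_p : forall i, fin_mean P (fun w => (i \in D w)%:R) = p.
Notation mean := (fin_mean P).

Definition xi (i : 'I_N) (w : T) : R := ((i \in D w)%:R - p) / s.
Definition eta (i : 'I_N) (w : T) : R := \sum_(j | near_ord 1 i j) xi j w.
Definition xi_sum (w : T) : R := \sum_i xi i w.

Hypothesis var1 : mean (fun w => xi_sum w ^+ 2) = 1.

Let b := s^-1.

Let b_gt0 : 0 < b. Proof. by rewrite invr_gt0. Qed.

Lemma xi_bound i w : `|xi i w| <= b.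
Proof.
rewrite normrM [`|b|]gtr0_norm // ler_piMl ?(ltW b_gt0) // ler_norml.
by case/andP: p01 => ? ?; case: (i \in D w) => /=; apply/andP; split; lra.
Qed.

Lemma mean_xi i : mean (xi i) = 0.
Proof.
transitivity (mean (fun w => s^-1 * ((i \in D w)%:R - p))).
  by apply: eq_fin_mean => w; rewrite /xi mulrC.
by rewrite fin_meanZ fin_meanB mean_p fin_mean_cst // subrr mulr0.
Qed.

Let xiS (i : 'I_N) (S : {set 'I_N}) : R := ((i \in S)%:R - p) / s.

Lemma xi_restrict (X : {set 'I_N}) i w : i \in X -> xi i w = xiS i (D w :&: X).
Proof. by move=> iX; rewrite /xi /xiS inE iX andbT. Qed.

Lemma eta_bound i w : `|eta i w| <= 3 * b.
Proof.
apply: le_trans (ler_norm_sum _ _ _) _.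
apply: (@le_trans _ _ (\sum_(j | near_ord 1 i j) b)).
  by apply: ler_sum => j _; apply: xi_bound.
rewrite big_mkcond (eq_bigr (fun j => (near_ord 1 i j)%:R * b)) => [|j _].
  by rewrite -big_distrl ler_wpM2r ?(ltW b_gt0) //; exact: sum_near.
by case: ifP; rewrite ?mul1r ?mul0r.
Qed.

Lemma total_sub_eta i w : xi_sum w - eta i w = \sum_(j | ~~ near_ord 1 i j) xi
  j w.
Proof.
apply/eqP; rewrite subr_eq addrC; apply/eqP.
by rewrite /xi_sum (bigID (near_ord 1 i)).
Qed.

(** Once [eta i] is removed, only positions at distance at least two from [i] remain, so [indep]
    applies and [xi i] is centered. *)
Lemma mean_xi_total i (f : R -> R) :
  mean (fun w => xi i w * f (xi_sum w - eta i w)) = 0.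
Proof.
pose Y := [set j | ~~ near_ord 1 i j]%SET.
pose h S := f (\sum_(j | ~~ near_ord 1 i j) xiS j S).
transitivity (mean (fun w => xiS i (D w :&: [set i]%SET) * h (D w :&: Y))).
  apply: eq_fin_mean => w; rewrite -xi_restrict ?inE // total_sub_eta; congr (_
    * f _).
  by apply: eq_bigr => j ij; apply: xi_restrict; rewrite inE.
rewrite indep => [|x y]; last first.
  by rewrite !inE => /eqP -> /near_ordPn.
rewrite (@eq_fin_mean _ _ _ _ (xi i)) ?mean_xi ?mul0r // => w.
by rewrite -xi_restrict ?inE.
Qed.

Lemma sum_xi_eta_mean : mean (fun w => \sum_i xi i w * eta i w) = 1.
Proof.
rewrite -var1 fin_mean_sum.
transitivity (mean (fun w => \sum_i xi i w * xi_sum w)); last first.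
  by apply: eq_fin_mean => w; rewrite expr2 /xi_sum big_distrl.
rewrite fin_mean_sum; apply: eq_bigr => i _.
rewrite -[RHS]subr0 -(mean_xi_total i id) -fin_meanB; apply: eq_fin_mean => w
  /=.
by ring.
Qed.

Let v i w := xi i w * eta i w.
Let u i w := v i w - mean (v i).

Lemma xi_eta_bound i w : `|v i w| <= 3 * b ^+ 2.
Proof.
rewrite normrM expr2 mulrCA; apply: ler_pM => //; first exact: xi_bound.
exact: eta_bound.
Qed.

Lemma centered_bound i w : `|u i w| <= 6 * b ^+ 2.
Proof.
apply: le_trans (ler_normB _ _) _.
have h1 := xi_eta_bound i w.
have h2 := norm_fin_mean_le P_dist (xi_eta_bound i); lra.
Qed.

Lemma mean_centered i : mean (u i) = 0.
Proof. by rewrite /u fin_meanB fin_mean_cst // subrr. Qed.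

(** [u i] depends on positions within 1 of [i]; at distance at least 4, two such neighbourhoods are
    at least 2 apart. *)
Lemma mean_centered_far i j : ~~ near_ord 3 i j -> mean (fun w => u i w * u j
  w) = 0.
Proof.
move=> ij.
pose B k : {set 'I_N} := [set l | near_ord 1 k l]%SET.
pose uS k S := xiS k S * (\sum_(l | near_ord 1 k l) xiS l S) - mean (v k).
have uE k w : u k w = uS k (D w :&: B k).
  rewrite /u /uS /v -xi_restrict; last by rewrite inE /near_ord; lia.
  congr (_ * _ - _); apply: eq_bigr => l kl.
  by apply: xi_restrict; rewrite inE.
transitivity (mean (fun w => uS i (D w :&: B i) * uS j (D w :&: B j))).
  by apply: eq_fin_mean => w; rewrite !uE.
rewrite indep => [|x y].
  rewrite (@eq_fin_mean _ _ _ _ (u i)) ?mean_centered ?mul0r //.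
by move: ij; rewrite !inE /near_ord; lia.
Qed.

(** The constant is [252 = 7 * 36]: at most 7 indices lie within 3 of [i], and each covariance is at
    most [(6 b^2)^2]. *)
Lemma sum_v_variance :
  mean (fun w => (\sum_i v i w - 1) ^+ 2) <= N%:R * (252 * b ^+ 4).
Proof.
have -> : mean (fun w => (\sum_i v i w - 1) ^+ 2) =
    \sum_i \sum_j mean (fun w => u i w * u j w).
  transitivity (mean (fun w => \sum_i \sum_j u i w * u j w)).
    apply: eq_fin_mean => w.
    have -> : \sum_i v i w - 1 = \sum_i u i w.
      by rewrite /u sumrB -fin_mean_sum sum_xi_eta_mean.
    by rewrite expr2 big_distrl; apply: eq_bigr => i _; rewrite /= big_distrr.
  by rewrite fin_mean_sum; apply: eq_bigr => i _; rewrite fin_mean_sum.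
apply: (@le_trans _ _ (\sum_(i < N) 252 * b ^+ 4)); last first.
  by rewrite sumr_const card_ord -[leLHS]mulr_natl.
apply: ler_sum => i _.
apply: (@le_trans _ _ (\sum_j (near_ord 3 i j)%:R * (36 * b ^+ 4))).
  apply: ler_sum => j _; case: (boolP (near_ord 3 i j)) => [_|ij]; last first.
    by rewrite mean_centered_far // mul0r.
  rewrite mul1r; apply: le_trans (ler_norm _) _; apply: norm_fin_mean_le => //
    w.
  rewrite normrM (_ : 36 * _ = (6 * b ^+ 2) * (6 * b ^+ 2)); last by ring.
  by apply: ler_pM => //; apply: centered_bound.
rewrite -big_distrl /=; have := sum_near R 3 i; rewrite /= => h.
rewrite (_ : 252 * _ = 7 * (36 * b ^+ 4)); last by ring.
by rewrite ler_wpM2r // mulr_ge0 // exprn_ge0 // ltW.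
Qed.

Variables (f g : R -> R) (L K : R).
Hypothesis f_der : forall x : R, is_derive x 1 f (g x).
Hypothesis L_ge0 : 0 <= L.
Hypothesis g_bound : forall x, `|g x| <= L.
Hypothesis g_lipschitz : forall x y, `|g x - g y| <= L * `|x - y|.
Hypothesis K_bound : N%:R * b ^+ 2 <= K.

Lemma taylor_bound x d : `|f x - f (x - d) - d * g x| <= L * d ^+ 2.
Proof.
have [c cx e] := mean_value x (x - d) f_der.
have -> : f x - f (x - d) - d * g x = d * (g c - g x).
  have {}e : f x - f (x - d) = d * g c by rewrite -opprB e; ring.
  by rewrite e; ring.
have {}cx : `|c - x| <= `|d|.
  by move: cx; rewrite [X in _ <= X -> _](_ : _ = `|d|) // -normrN; congr `|_|;
    ring.
rewrite normrM -real_normK ?num_real // expr2 mulrCA ler_wpM2l //.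
by apply: le_trans (g_lipschitz _ _) _; rewrite ler_wpM2l.
Qed.

(** As [xi i] is uncorrelated with [f (xi_sum - eta i)], only an increment of [f] over [eta i] is
    left, and [taylor_bound] with [|eta i| <= 3 b] yields the 9. *)
Lemma stein_linear_bound :
  `|mean (fun w => xi_sum w * f (xi_sum w)) -
    mean (fun w => g (xi_sum w) * \sum_i v i w)| <= 9 * L * K * b.
Proof.
have -> : mean (fun w => xi_sum w * f (xi_sum w)) -
    mean (fun w => g (xi_sum w) * \sum_i v i w) =
    \sum_i mean (fun w => xi i w *
      (f (xi_sum w) - f (xi_sum w - eta i w) - eta i w * g (xi_sum w))).
  have -> : mean (fun w => xi_sum w * f (xi_sum w)) =
      \sum_i mean (fun w => xi i w * (f (xi_sum w) - f (xi_sum w - eta i w))).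
    rewrite (@eq_fin_mean _ _ _ _ (fun w => \sum_i xi i w * f (xi_sum w))) =>
      [|w].
      rewrite fin_mean_sum; apply: eq_bigr => i _.
      rewrite -[LHS]subr0 -(mean_xi_total i f) -fin_meanB.
      by apply: eq_fin_mean => w; rewrite mulrBr.
    by rewrite {1}/xi_sum big_distrl.
  rewrite (@eq_fin_mean _ _ _ _ (fun w => \sum_i g (xi_sum w) * v i w)) => [|w].
    rewrite fin_mean_sum -sumrB; apply: eq_bigr => i _; rewrite -fin_meanB.
    by apply: eq_fin_mean => w; rewrite /v; ring.
  by rewrite big_distrr.
apply: le_trans (ler_norm_sum _ _ _) _.
apply: (@le_trans _ _ (\sum_(i < N) b * (L * (3 * b) ^+ 2))).
  apply: ler_sum => i _; apply: norm_fin_mean_le => // w.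
  rewrite normrM ler_pM //; first exact: xi_bound.
  apply: le_trans (taylor_bound _ _) _; rewrite ler_wpM2l //.
  by rewrite -real_normK ?num_real // ler_sqr ?nnegrE ?eta_bound // mulr_ge0 //
    ltW.
rewrite sumr_const card_ord -[leLHS]mulr_natl.
rewrite [leLHS](_ : _ = 9 * L * (N%:R * b ^+ 2) * b); last by ring.
by rewrite ler_pM2r // ler_wpM2l // mulr_ge0.
Qed.

(** An elementary inequality replaces Cauchy-Schwarz: the variance is at most [252 K b^2], so
    dividing it by [b] keeps the order [b]. *)
Lemma stein_quadratic_bound :
  `|mean (fun w => g (xi_sum w) * (1 - \sum_i v i w))| <= L * b * (1 + 252 * K).
Proof.
apply: (@le_trans _ _ (mean (fun w => L * (b + b^-1 * (\sum_i v i w - 1) ^+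
  2)))).
  apply: le_trans (ler_norm_sum _ _ _) _; apply: ler_sum => w _.
  rewrite normrM ger0_norm; last by case: P_dist.
  apply: ler_wpM2l; first by case: P_dist.
  rewrite normrM ler_pM // distrC; set y := \sum_i v i w - 1.
  (* [|y| <= b + y^2 / b] *)
  rewrite -(ler_pM2l b_gt0) mulrDr mulrA mulfV ?gt_eqF // mul1r -[y ^+
    2]real_normK ?num_real //.
  by have := normr_ge0 y; nra.
rewrite fin_meanZ -mulrA ler_wpM2l // fin_meanD fin_mean_cst // fin_meanZ.
rewrite mulrDr mulr1 lerD2l ler_pdivrMl //.
apply: le_trans sum_v_variance _.
rewrite (_ : N%:R * _ = (N%:R * b ^+ 2) * (252 * b ^+ 2)); last by ring.
rewrite (_ : b * _ = K * (252 * b ^+ 2)); last by ring.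
by apply: ler_wpM2r K_bound; apply: mulr_ge0; [exact: ler0n|exact: sqr_ge0].
Qed.

Lemma stein_local_dependence :
  `|mean (fun w => g (xi_sum w) - xi_sum w * f (xi_sum w))| <= L * b * (1 + 261
    * K).
Proof.
have -> : mean (fun w => g (xi_sum w) - xi_sum w * f (xi_sum w)) =
    mean (fun w => g (xi_sum w) * (1 - \sum_i v i w)) -
    (mean (fun w => xi_sum w * f (xi_sum w)) -
     mean (fun w => g (xi_sum w) * \sum_i v i w)).
  rewrite opprB addrA -fin_meanD -fin_meanB; apply: eq_fin_mean => w; ring.
apply: le_trans (ler_normB _ _) _.
have h1 := stein_quadratic_bound; have h2 := stein_linear_bound.
by rewrite (_ : L * b * _ = L * b * (1 + 252 * K) + 9 * L * K * b); [exact: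
  lerD|ring].
Qed.

End LocalDependence.

(** * The central limit theorem for the number of descents *)

Section CentralLimit.
Variables (R : realType) (q : R).
Hypotheses (q_gt0 : 0 < q) (q_lt1 : q < 1).
Notation runp := (runprob q).

(** This is the coefficient of [n] in the exact variance. *)
Definition var_rate : R :=
  q * (q ^+ 2 - q + 1) / ((q ^+ 2 + q + 1) * (q + 1) ^+ 2).

Let den_gt0 : 0 < (q ^+ 2 + q + 1) * (q + 1) ^+ 2.
Proof. by rewrite mulr_gt0 ?exprn_gt0 ?addr_gt0 ?exprn_gt0. Qed.

Lemma var_rate_gt0 : 0 < var_rate.
Proof.
have a : 0 < q ^+ 2 - q + 1 by have := sqr_ge0 q; have := q_lt1; lra.
by apply: divr_gt0; [exact: mulr_gt0|exact: den_gt0].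
Qed.

Definition std_descents N (w : 'S_N.+1) : R :=
  standardize (mallows N.+1 q) (fun w => (descents w)%:R) w.

Lemma var_descents_ge N : (0 < N)%N ->
  N%:R * var_rate <= fin_var (mallows N.+1 q) (fun w => (descents w)%:R).
Proof.
move=> N0; rewrite var_descents // -subr_ge0 /var_rate -natr1.
set den := _ * _ ^+ 2; have den0 : den != 0 by rewrite gt_eqF.
rewrite (_ : _ - _ = 2 * q ^+ 2 / den); last by field.
by apply: divr_ge0; [rewrite mulr_ge0 // sqr_ge0|exact: ltW den_gt0].
Qed.

(** By Stein's equation the difference is the mean of [f'(W) - W f(W)]. Linear growth of the
    variance enters through [K = 1 / var_rate], so that [C] does not depend on [N]. *)
Lemma mean_plateau_bound t e : 0 < e -> exists2 C : R, 0 <= C &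
  forall N, (0 < N)%N ->
  `|fin_mean (mallows N.+1 q) (fun w => plateau t e (std_descents w)) -
    plateau_mean t e|
    <= C * (Num.sqrt (fin_var (mallows N.+1 q) (fun w => (descents w)%:R)))^-1.
Proof.
move=> e0; have [L L0 [gL gLip]] := stein_lipschitz t e0.
have k0 := var_rate_gt0.
exists (L * (1 + 261 * var_rate^-1)).
  apply: (mulr_ge0 L0); apply: (addr_ge0 ler01).
  by apply: mulr_ge0; [exact: ler0n|rewrite invr_ge0 ltW].
move=> N N0; set V := fin_var _ _.
have N0' : 0 < N%:R :> R by rewrite ltr0n.
have Vge : N%:R * var_rate <= V by apply: var_descents_ge.
have V0 : 0 < V by apply: lt_le_trans Vge; rewrite mulr_gt0.
pose s := Num.sqrt V; have s0 : 0 < s by rewrite sqrtr_gt0.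
have s2 : s ^+ 2 = V by rewrite sqr_sqrtr // ltW.
have dP := mallows_distribution q_gt0 q_lt1 N.
pose D (w : 'S_N.+1) : {set 'I_N} := descent_set w.
pose W := xi_sum D (runp 1) s.
have WE w : std_descents w = W w.
  rewrite /std_descents /standardize (mean_descents q_gt0 q_lt1) -/V -/s /W
    /xi_sum /xi.
  rewrite descents_ind -big_distrl /=; congr (_ / _).
  by rewrite sumrB sumr_const card_ord mulr_natl.
have p01 : 0 <= runp 1 <= 1.
  rewrite runp1 // divr_ge0 ?addr_ge0 ?(ltW q_gt0) //=.
  by rewrite ler_pdivrMr ?addr_gt0 // mul1r lerDl.
have var1 : fin_mean (mallows N.+1 q) (fun w => W w ^+ 2) = 1.
  rewrite (@eq_fin_mean _ _ _ _ (fun w => V^-1 * ((descents w)%:R -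
      fin_mean (mallows N.+1 q) (fun w => (descents w)%:R)) ^+ 2)).
    by rewrite fin_meanZ -/(fin_var _ _) -/V mulVf // gt_eqF.
  by move=> w; rewrite -WE /std_descents /standardize -/V -/s expr_div_n s2
    mulrC.
have Kb : N%:R * s^-1 ^+ 2 <= var_rate^-1.
  by rewrite exprVn s2 ler_pdivrMr // ler_pdivlMl // mulrC.
have indep := fin_mean_indep q_gt0 q_lt1 (N := N).
have means i : fin_mean (mallows N.+1 q) (fun w => (i \in D w)%:R) = runp 1.
  exact: (mean_ind q_gt0 q_lt1 i).
have := stein_local_dependence dP indep p01 s0 means var1
  (is_derive_stein t e0) L0 gL gLip Kb.
rewrite -/W => bd.
rewrite -(fin_mean_cst (plateau_mean t e) dP) -fin_meanB.
rewrite (@eq_fin_mean _ _ _ _ (fun w => stein_der t e (W w) - W w * stein_sol t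
  e (W w))).
  by apply: le_trans bd _; rewrite mulrAC.
by move=> w; rewrite WE /stein_der; ring.
Qed.

Lemma inv_std_small d : 0 < d -> exists n0, forall N, (n0 <= N)%N -> (0 < N)%N
  ->
  (Num.sqrt (fin_var (mallows N.+1 q) (fun w => (descents w)%:R)))^-1 <= d.
Proof.
move=> d0; have k0 := var_rate_gt0.
pose y := (d ^+ 2 * var_rate)^-1.
exists (Num.truncn y).+1 => N nN N0.
have Ny : y <= N%:R by apply: le_trans (ltW (truncnS_gt y)) _; rewrite ler_nat.
have V1 : d^-1 ^+ 2 <= fin_var (mallows N.+1 q) (fun w => (descents w)%:R).
  apply: le_trans (var_descents_ge N0); rewrite -ler_pdivrMr // exprVn -invfM
    //.
rewrite -[leRHS]invrK lef_pV2 ?posrE ?invr_gt0 ?sqrtr_gt0 //.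
  rewrite -[leLHS]ger0_norm ?invr_ge0 ?(ltW d0) // -sqrtr_sqr.
  by rewrite ler_sqrt // (le_trans _ V1) // sqr_ge0.
by apply: lt_le_trans V1; rewrite exprn_gt0 // invr_gt0.
Qed.

Lemma mean_plateau_cvg t e d : 0 < e -> 0 < d -> exists n0, forall N,
  (n0 <= N)%N -> (0 < N)%N ->
  `|fin_mean (mallows N.+1 q) (fun w => plateau t e (std_descents w)) -
    plateau_mean t e| <= d.
Proof.
move=> e0 d0; have [C C0 HC] := mean_plateau_bound t e0.
have [|n0 H] := @inv_std_small (d / (C + 1)); first by rewrite divr_gt0 //
  ltr_wpDl.
exists n0 => N nN N0; apply: le_trans (HC N N0) _.
apply: (@le_trans _ _ (C * (d / (C + 1)))); first by rewrite ler_wpM2l // H.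
by rewrite mulrA ler_pdivrMr ?ltr_wpDl // mulrC ler_wpM2l ?(ltW d0) // lerDl.
Qed.

Lemma gcdf_lipschitz (x y : R) : `|gcdf x - gcdf y| <= normal_peak 1 * `|x - y|.
Proof.
have [c _ ->] := mean_value y x (@is_derive_gcdf R).
by rewrite normrM ler_wpM2r // gtr0_norm ?gpdf_gt0 // gpdf_ub.
Qed.

(** The indicator lies between the plateaus started at [t - e] and [t]. As [normal_peak 1] is a
    Lipschitz constant of [gcdf], this [e] costs [d / 2]; the other half goes to the convergence of
    the means. *)
Lemma cdf_descents_cvg (t d : R) : 0 < d -> exists n0, forall N,
  (n0 <= N)%N -> (0 < N)%N ->
  `|fin_prob (mallows N.+1 q) [set w : 'S_N.+1 | std_descents w <= t] - gcdf t|
    <= d.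
Proof.
move=> d0; have K0 : 0 < normal_peak 1 :> R by rewrite normal_peak_gt0 //
  oner_neq0.
pose e := d / 2 / normal_peak 1.
have e0 : 0 < e by rewrite !divr_gt0.
have d2 : 0 < d / 2 by rewrite divr_gt0.
have Ke : normal_peak 1 * e = d / 2 by rewrite /e mulrC divfK // gt_eqF.
have [n1 H1] := mean_plateau_cvg t e0 d2.
have [n2 H2] := mean_plateau_cvg (t - e) e0 d2.
exists (maxn n1 n2) => N; rewrite geq_max => /andP[N1 N2] N0.
have dP := mallows_distribution q_gt0 q_lt1 N.
have up : fin_prob (mallows N.+1 q) [set w : 'S_N.+1 | std_descents w <= t] <=
    fin_mean (mallows N.+1 q) (fun w => plateau t e (std_descents w)).
  rewrite fin_probE; apply: (ler_fin_mean dP) => w.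
  case: (leP (std_descents w) t) => [h|_] /=; first by rewrite plateau_l.
  by have /andP[] := plateau_bounds t e0 (std_descents w).
have lo : fin_mean (mallows N.+1 q) (fun w => plateau (t - e) e (std_descents
  w)) <=
    fin_prob (mallows N.+1 q) [set w : 'S_N.+1 | std_descents w <= t].
  rewrite fin_probE; apply: (ler_fin_mean dP) => w.
  case: (leP (std_descents w) t) => [_|h] /=.
    by have /andP[] := plateau_bounds (t - e) e0 (std_descents w).
  by rewrite plateau_r // subrK ltW.
have /andP[_ b1] := plateau_mean_bounds t e0.
have /andP[b2 _] := plateau_mean_bounds (t - e) e0.
have l1 := gcdf_lipschitz (t + e) t; have l2 := gcdf_lipschitz t (t - e).
rewrite (_ : t + e - t = e) in l1; last by ring.
rewrite (_ : t - (t - e) = e) in l2; last by ring.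
rewrite (gtr0_norm e0) Ke in l1; rewrite (gtr0_norm e0) Ke in l2.
have h1 := H1 N N1 N0; have h2 := H2 N N2 N0.
move: l1 l2 h1 h2; rewrite !ler_norml.
move=> /andP[_ l1] /andP[_ l2] /andP[_ h1] /andP[h2 _].
apply/andP; split.
  by move: lo b2 l2 h2; clear; lra.
by move: up b1 l1 h1; clear; lra.
Qed.

Lemma descents_asymptotically_normal :
  asymptotically_normal (T := fun n => 'S_n) (fun n => mallows n q)
    (fun n w => (descents w)%:R).
Proof.
move=> t; rewrite gcdf_prob; apply: cvg_EFin; first exact: nearW.
apply/cvgrPdist_le => d d0; have [n0 H] := cdf_descents_cvg t d0.
(* With [n = N.+1], this threshold ensures both [n0 <= N] and [0 < N]. *)
exists (n0.+2) => // -[//|N] /= nN.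
by rewrite distrC; apply: H; lia.
Qed.

End CentralLimit.

Theorem proposition5p2 (R : realType) (q : R) (q_gt0 : 0 < q) (q_lt1 : q < 1) :
  (forall n : nat, (2 <= n)%N ->
    (* (a) *)
    (forall s : seq nat, sorted ltn s -> all (fun x => 0 < x < n)%N s ->
       let t := 0%N :: rcons s n in
       fin_prob (mallows n q)
         [set w | descent_set w == [set x : 'I_n.-1 | x.+1 \in s]] =
       \det (\matrix_(i < (size s).+1, j < (size s).+1)
               inv_qfact q ((nth 0%N t j.+1)%:Z - (nth 0%N t i)%:Z)))
    /\
    (* (b) *)
    [/\ is_distribution (descent_process n q),
        stationary (descent_process n q),
        one_dependent (descent_process n q)
      & exists F k : int -> R,
          [/\ laurent_inverse (inv_qfact q) F,
              laurent_inverse (fun m => laurent_one R m - F m) k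
            & determinantal (descent_process n q)
                (fun x y => k (y%:Z - x%:Z))]]
    /\
    (* (c) *)
    [/\ forall a k : nat, (1 <= a)%N -> (a + k <= n)%N ->
          fin_prob (mallows n q)
            [set w | [forall x : 'I_n.-1,
               (a <= x.+1 < a + k)%N ==> (x \in descent_set w)]] =
          q ^+ 'C(k.+1, 2) / qfact q k.+1,
        forall x : 'I_n.-1,
          fin_prob (mallows n q) [set w | x \in descent_set w] = q / (q + 1),
        fin_mean (mallows n q) (fun w => (descents w)%:R) =
          (n%:R - 1) * q / (q + 1)
      & fin_var (mallows n q) (fun w => (descents w)%:R) =
          q * (((q ^+ 2 - q + 1) * n%:R - q ^+ 2 + 3 * q - 1) /
               ((q ^+ 2 + q + 1) * (q + 1) ^+ 2))])
  /\
  (* (c), limiting normal distribution *)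
  asymptotically_normal (T := fun n => 'S_n) (fun n => mallows n q)
    (fun n w => (descents w)%:R).
Proof.
split; last exact: descents_asymptotically_normal.
case=> [|[|N]] // _; split; [|split].
- by move=> s srt bnd; apply: descent_set_prob.
- split.
  + exact: process_distribution.
  + exact: process_stationary.
  + exact: process_one_dependent.
  exists (qexp_inv q), (kernel q); split.
  + exact: qexp_inverse.
  + exact: kernel_inverse.
  exact: process_determinantal.
split.
- by move=> a k a1 akn; apply: run_prob.
- by move=> x; rewrite (descent_prob q_gt0 q_lt1) runp1.
- by rewrite mean_descents // runp1 // -[N.+2%:R]natr1 addrK mulrA.
by rewrite var_descents.
Qed.
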